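(* For $T\in\mathbf{T}_n^2$ one has $$\overline{\mathcal{U}}_T=\bigcup_{S\in\mathbf{T}_n^2,\ S\geq T}\mathcal{U}_S .$$
   Context: Let $\mathfrak{n}$ be the space of strictly upper-triangular complex $n\times n$ matrices and $\mathbf{B}$ the group of invertible upper-triangular matrices acting on $\mathfrak{n}$ by conjugation. The bar denotes (Zariski) closure in $\mathfrak{n}$. For $u\in\mathfrak n$ let $\pi_{1,i}(u)$ be the upper-left $i\times i$ submatrix of $u$. For a nilpotent matrix $u$ let $\mathrm{sh}(u)=\lambda=(\lambda_1,\lambda_2,\dots)$ be the conjugate (dual) of the partition formed by the sizes of its Jordan blocks, i.e. $\lambda_i$ is the number of Jordan blocks of size at least $i$; let $\mathcal{O}_\lambda$ be the set of nilpotent $n\times n$ matrices $u$ with $\mathrm{sh}(u)=\lambda$. A Young diagram of shape $\lambda$ has $i$-th column of length $\lambda_i$; a standard Young tableau is a filling with $1,\dots,n$ increasing along rows (left to right) and down columns. For a standard Young tableau $T$ of shape $\lambda$ let $\nu_T$ be the set of $u\in\mathfrak{n}$ such that for every $1\le i\le n$, $\mathrm{sh}(\pi_{1,i}(u))$ equals the shape of the subtableau of $T$ consisting of the entries $1,\dots,i$. The orbital variety attached to $T$ is $\mathcal{U}_T=\overline{\nu_T}\cap\mathcal{O}_\lambda$. $\mathbf{T}_n^2$ is the set of standard Young tableaux with $n$ boxes and at most two columns; write $T=(T_1,T_2)$ with second column $T_2$ with entries $t_{1,2}<\dots<t_{k,2}$ ($k=0$ if there is one column only). Define the involution $\sigma_T=(i_1,j_1)\cdots(i_k,j_k)$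 by $j_s=t_{s,2}$, $i_1=t_{1,2}-1$, and $i_s=\max\{d\in T_1\setminus\{i_1,\dots,i_{s-1}\} : d<j_s\}$ for $s>1$. Let $N_{\sigma_T}$ be the matrix with entries $1$ at positions $(i_s,j_s)$, $1\le s\le k$, and $0$ elsewhere, and let $\mathcal{B}_T$ be the $\mathbf{B}$-orbit of $N_{\sigma_T}$. For $S,T\in\mathbf{T}_n^2$ put $S\ge T$ if $\overline{\mathcal{B}}_S\subset\overline{\mathcal{B}}_T$. *)

(* Defs.v *)
From HB Require Import structures.
From mathcomp Require Import all_boot all_order all_algebra.
From mathcomp Require Import mpoly complex.
From mathcomp Require Import boolp classical_sets reals.

Set Implicit Arguments.
Unset Strict Implicit.
Unset Printing Implicit Defensive.

Import Order.TTheory GRing.Theory Num.Theory.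

Local Open Scope classical_set_scope.
Local Open Scope ring_scope.

Section MatrixSets.

Variable (F : fieldType) (n : nat).

Definition strictly_upper : set 'M[F]_n :=
  [set u | forall i j : 'I_n, (j <= i)%N -> u i j = 0].

Definition borel : set 'M[F]_n :=
  [set A | A \in unitmx /\ forall i j : 'I_n, (j < i)%N -> A i j = 0].

Definition borel_orbit (u : 'M[F]_n) : set 'M[F]_n :=
  [set A *m u *m invmx A | A in borel].

Definition nilpotent_mx : set 'M[F]_n := [set u | exists k : nat, u ^+ k = 0].

(* Polynomials in the n * n matrix entries restrict onto the polynomial
   functions on the linear subspace of strictly upper-triangular matrices, so
   these are the Zariski closed subsets of that subspace. *)
Definition zariski_closed (Z : set 'M[F]_n) : Prop :=
  exists I : set {mpoly F[n * n]},
    Z = [set u | strictly_upper u /\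
                 forall p, I p -> p.@[fun k => mxvec u ord0 k] = 0].

Definition zariski_closure (A : set 'M[F]_n) : set 'M[F]_n :=
  smallest zariski_closed A.

End MatrixSets.

Definition nilpotent_jordan_block (F : fieldType) (m : nat) : 'M[F]_m :=
  \matrix_(i, j) (i.+1 == j :> nat)%:R.

Definition nilpotent_jordan_mx (F : fieldType) (mu : seq nat) :
    'M[F]_(\sum_(k < size mu) nth 0%N mu k) :=
  \mxdiag_(k < size mu) nilpotent_jordan_block F (nth 0%N mu k).

(* mu lists the Jordan block sizes of u in an arbitrary order. *)
Definition jordan_block_sizes (F : fieldType) (n : nat) (u : 'M[F]_n)
    (mu : seq nat) : Prop :=
  0%N \notin mu /\
  exists (e : (\sum_(k < size mu) nth 0 mu k)%N = n) (P : 'M[F]_n),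
    P \in unitmx /\
    u = P *m castmx (e, e) (nilpotent_jordan_mx F mu) *m invmx P.

Definition conjugate_partition (mu : seq nat) : seq nat :=
  [seq count (leq i) mu | i <- iota 1 (\max_(m <- mu) m)].

(* sh(u) = lam *)
Definition has_sh (F : fieldType) (n : nat) (u : 'M[F]_n) (lam : seq nat) :
    Prop :=
  exists2 mu : seq nat, jordan_block_sizes u mu & lam = conjugate_partition mu.

Definition nilpotent_class (F : fieldType) (n : nat) (lam : seq nat) :
    set 'M[F]_n :=
  [set u | nilpotent_mx u /\ has_sh u lam].

Definition upper_left (F : fieldType) (n i : nat) (le_in : (i <= n)%N)
    (u : 'M[F]_n) : 'M[F]_i :=
  mxsub (widen_ord le_in) (widen_ord le_in) u.

(* A tableau is the list of its columns, each one read from top to bottom. *)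
Definition tableau := seq (seq nat).

Definition shape (T : tableau) : seq nat := [seq size c | c <- T].

Definition standard_tableau (n : nat) (T : tableau) : Prop :=
  [/\ [::] \notin T,
      sorted geq (shape T),
      perm_eq (flatten T) (iota 1 n),
      all (sorted ltn) T
    & forall c r : nat, (r < size (nth [::] T c.+1))%N ->
        (nth 0 (nth [::] T c) r < nth 0 (nth [::] T c.+1) r)%N].

Definition subtableau (i : nat) (T : tableau) : tableau :=
  [seq c <- [seq [seq x <- d | (x <= i)%N] | d <- T] | c != [::]].

Definition nu (F : fieldType) (n : nat) (T : tableau) : set 'M[F]_n :=
  [set u | strictly_upper u /\
     forall (i : nat) (le_in : (i <= n)%N), (0 < i)%N ->
       has_sh (upper_left le_in u) (shape (subtableau i T))].

Definition orbital_variety (F : fieldType) (n : nat) (T : tableau) :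
    set 'M[F]_n :=
  zariski_closure (@nu F n T) `&` @nilpotent_class F n (shape T).

Definition two_column_tableaux (n : nat) : set tableau :=
  [set T | standard_tableau n T /\ (size T <= 2)%N].

(* The pairs (i_s, j_s), s > 1, given the column T1, the list used of the
   previous i's and the remaining j's. *)
Fixpoint sigma_rest (T1 used js : seq nat) : seq (nat * nat) :=
  if js is j :: js' then
    let i := (\max_(d <- T1 | (d \notin used) && (d < j)%N) d)%N in
    (i, j) :: sigma_rest T1 (i :: used) js'
  else [::].

(* The list of the transpositions (i_s, j_s) of sigma_T. *)
Definition sigma (T : tableau) : seq (nat * nat) :=
  let T1 := nth [::] T 0 in
  let T2 := nth [::] T 1 in
  if T2 is j1 :: js then (j1.-1, j1) :: sigma_rest T1 [:: j1.-1] js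
  else [::].

(* Tableau entries are counted from 1, matrix indices from 0. *)
Definition N_sigma (F : fieldType) (n : nat) (T : tableau) : 'M[F]_n :=
  \matrix_(i < n, j < n) ((i.+1, j.+1) \in sigma T)%:R.

Definition orbit_B (F : fieldType) (n : nat) (T : tableau) : set 'M[F]_n :=
  borel_orbit (N_sigma F n T).

(* S >= T *)
Definition tableau_ge (F : fieldType) (n : nat) (S T : tableau) : Prop :=
  zariski_closure (@orbit_B F n S) `<=` zariski_closure (@orbit_B F n T).

(* Main.v *)
Require Import Defs.
From mathcomp Require Import all_boot all_order all_fingroup all_algebra.
From mathcomp Require Import zify ring.
From mathcomp Require Import mpoly complex.
From mathcomp Require Import boolp classical_sets reals.

Set Implicit Arguments.
Unset Strict Implicit.
Unset Printing Implicit Defensive.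

Import Order.TTheory GRing.Theory Num.Theory.

(* A strictly upper triangular u of square zero is Borel conjugate to the 0/1
   matrix N_s of a partial matching, i.e. of an involution s of {0, .., n-1}
   whose fixed points are unmatched, and the rank of the corner of N_s with rows
   at least i and columns less than j is the number of arcs of s in [i, j).
   Noncrossing matchings without unmatched points below an arc ("planar" ones)
   correspond to two-column tableaux, the second column listing the right ends
   of the arcs ("closers"), and the planar matching of T is sigma_T.
   If a < b < s a while b is unmatched or matched beyond s a, then conjugating s
   by (b  s a) or by (a b) gives a matching whose Borel orbit has N_s in its
   closure.  The second move preserves the closers, so nu_T lies in the closure
   of B_T.  If moreover all arc counts of s are bounded by those of a planar t,
   one of the two moves keeps this bound: otherwise two overlapping intervals
   would have equal counts for s and t, which is impossible.  Hence s, when it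
   has as many arcs as t, degenerates from t; and when it has fewer, an outer
   arc of t can be removed without breaking the bound.  So every u in the
   closure of U_T lies in U_S, where S comes from T by removing outer arcs. *)

(** * Partial matchings *)

Lemma ord_eqE n (a b : 'I_n) : (a == b) = (a == b :> nat).
Proof. by []. Qed.

Section Matchings.
Local Open Scope nat_scope.
Variable n : nat.
Implicit Types (s t : 'S_n) (a b c : 'I_n).

Definition arcs_in s (i j : nat) : nat :=
  \sum_(a < n) [&& i <= a, a < s a & s a < j].

Definition planar s : Prop :=
  forall a b, a < b -> b < s a -> [/\ s b != b, a < s b & s b < s a].

Definition obstruction s a b : bool :=
  [&& a < b, b < s a & (s b == b) || (s a < s b)].

(** A crossing to the left, [s b < a < b < s a], is not an obstruction at [(a, b)], but it is one at
    [(s b, a)]. Recording crossings to the right and unmatched points therefore suffices. *)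
Lemma planarP s : involutive s ->
  (forall a b, ~~ obstruction s a b) -> planar s.
Proof.
move=> sK ob a b ab bsa; have := ob a b.
rewrite /obstruction ab bsa /= negb_or -leqNgt => /andP[sbb le_sb].
have ne_sb : s b != s a by rewrite (inj_eq perm_inj) ord_eqE; lia.
have lt_sb : s b < s a by rewrite ltn_neqAle ne_sb.
split=> //; case: (ltngtP a (s b)) => // [sb_lt|eqa].
  have := ob (s b) a; rewrite /obstruction sb_lt sK ab bsa orbT //.
move: bsa; rewrite (_ : a = s b) ?sK ?ltnn //; exact: val_inj.
Qed.

Lemma arcs_in_closers s i j : involutive s ->
  arcs_in s i j = \sum_(b < n) [&& i <= s b, s b < b & b < j].
Proof.
by move=> sK; rewrite /arcs_in (reindex_inj (@perm_inj _ s));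
  apply: eq_bigr => b _; rewrite sK.
Qed.

(** Inclusion-exclusion: an arc in [[x, w)] that lies in neither [[x, z)] nor [[y, w)] joins
    [[x, y)] to [[z, w)]. *)
Lemma arcs_in_span s x y z w : x <= y -> y <= z -> z <= w ->
  arcs_in s x w + arcs_in s y z =
  arcs_in s x z + arcs_in s y w +
    \sum_(a < n) [&& x <= a, a < y, z <= s a & s a < w].
Proof.
move=> xy yz zw; rewrite /arcs_in -!big_split /=.
by apply: eq_bigr => a _; lia.
Qed.

(** Arcs in [[x, z)] but not in [[x, y)] have their right end in [[y, z)]; arcs in [[y, w)] but not
    in [[z, w)] have their left end there. Together these ends are the points of [[y, z)] matched
    inside [[x, w)], each counted once. *)
Lemma arcs_in_middle s x y z w : involutive s -> x <= y -> y <= z -> z <= w ->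
  arcs_in s x z + arcs_in s y w =
  arcs_in s x y + arcs_in s z w +
    \sum_(b < n) [&& y <= b, b < z, s b != b, x <= s b & s b < w].
Proof.
move=> sK xy yz zw.
rewrite (arcs_in_closers x z) // (arcs_in_closers x y) // /arcs_in -!big_split /=.
by apply: eq_bigr => b _; rewrite !ord_eqE; lia.
Qed.

Lemma arcs_in_matched s i j : involutive s ->
  (arcs_in s i j).*2 =
  \sum_(b < n) [&& i <= b, b < j, s b != b, i <= s b & s b < j].
Proof.
move=> sK; rewrite -addnn {1}arcs_in_closers // /arcs_in -big_split /=.
by apply: eq_bigr => b _; rewrite !ord_eqE; lia.
Qed.

Lemma leq_arcs_in s i j i' j' : i' <= i -> j <= j' ->
  arcs_in s i j <= arcs_in s i' j'.
Proof. by move=> ii jj; apply: leq_sum => a _; lia. Qed.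

Lemma arcs_in_le s i j : arcs_in s i j <= n.
Proof.
rewrite -[X in _ <= X](card_ord n) -sum1_card; apply: leq_sum => a _; lia.
Qed.

(** By [matching_corner_rank] this compares all corner ranks of the two matching matrices, a
    necessary condition for the orbit of [s] to lie in the closure of that of [t]. *)
Definition arcs_le s t : Prop := forall i j, arcs_in s i j <= arcs_in t i j.

Lemma ord_card_interval i j : i <= j -> j <= n ->
  \sum_(b < n) [&& i <= b & b < j] = j - i.
Proof.
move=> ij jn; rewrite -(big_mkord xpredT (fun k : nat => nat_of_bool ((i <= k) && (k < j)))).
rewrite (@big_cat_nat _ _ _ i) //= ?(leq_trans ij) //.
rewrite big_nat big1 ?add0n; last by move=> b; lia.
rewrite (@big_cat_nat _ _ _ j) //= [X in _ + X]big_nat [X in _ + X]big1.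
  rewrite addn0 big_nat (eq_bigr (fun=> 1)); last by move=> b; lia.
  by rewrite -big_nat sum_nat_const_nat muln1.
by move=> b; lia.
Qed.

Section Tight.
Variables (s t : 'S_n).
Hypotheses (sK : involutive s) (tK : involutive t) (le_st : arcs_le s t).

(* Either no arc of t joins the outer parts, and then arcs_in_span is an
   equality for t that s violates, or all of the middle is matched by t inside
   [x, w), and then arcs_in_middle gives the contradiction. *)
Lemma tight_overlap x y z w a b : planar t -> x <= y -> y <= z -> z <= w ->
  arcs_in s x z = arcs_in t x z -> arcs_in s y w = arcs_in t y w ->
  [&& x <= a, a < y, z <= s a & s a < w] ->
  y <= b < z -> (s b == b) || ~~ (x <= s b < w) -> False.
Proof.
move=> plt xy yz zw txz tyw arc_a mid_b out_b.
have [/existsP[c arc_c]|/existsPn noarc] := boolP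
  [exists c : 'I_n, [&& x <= c, c < y, z <= t c & t c < w]].
- have le1 := le_st x y; have le2 := le_st z w.
  have es := arcs_in_middle sK xy yz zw.
  have et := arcs_in_middle tK xy yz zw.
  suff : \sum_(b < n) [&& y <= b, b < z, s b != b, x <= s b & s b < w] <
         \sum_(b < n) [&& y <= b, b < z, t b != b, x <= t b & t b < w] by lia.
  have mid_t (d : 'I_n) : y <= d < z -> [&& y <= d, d < z, t d != d, x <= t d & t d < w].
    by move=> yd; move: arc_c => /and4P[xc cy zc cw]; have [||-> td1 td2] := plt c d; lia.
  rewrite (bigD1 b) //= [ltnRHS](bigD1 b) //= (mid_t b) // -addSn leq_add //.
    lia.
  by apply: leq_sum => d _; case: (boolP (y <= d < z)) => [/mid_t -> |]; lia.
- have le1 := le_st x w; have le2 := le_st y z.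
  have es := arcs_in_span s xy yz zw; have et := arcs_in_span t xy yz zw.
  have noarc0 : \sum_(a < n) [&& x <= a, a < y, z <= t a & t a < w] = 0.
    by apply: big1 => c _; rewrite (negPf (noarc c)).
  have pos : 0 < \sum_(a < n) [&& x <= a, a < y, z <= s a & s a < w].
    by rewrite (bigD1 a) //= arc_a.
  lia.
Qed.

End Tight.

Lemma conj_involutive s u : involutive s -> involutive (s ^ u)%g.
Proof. by move=> sK x; rewrite -[x](permKV u) !permJ sK. Qed.

(** * The two moves that resolve an obstruction *)

Section Moves.
Variables (s : 'S_n) (sK : involutive s) (a b : 'I_n).
Hypothesis (ob : obstruction s a b).

Let ab : a < b. Proof. by case/and3P: ob. Qed.
Let bc : b < s a. Proof. by case/and3P: ob. Qed.
Let obd : (s b == b) || (s a < s b). Proof. by case/and3P: ob. Qed.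

Let sum_two (f g : 'I_n -> nat) k :
  (forall x, x != a -> x != b -> f x = g x) ->
  f a + f b = g a + g b + k -> \sum_x f x = \sum_x g x + k.
Proof.
move=> fg fgab; have ba : b != a by rewrite !ord_eqE; lia.
rewrite (bigD1 a) //= (bigD1 b) //= [in RHS](bigD1 a) //= [in RHS](bigD1 b) //=.
rewrite (eq_bigr g) => [|x /andP[xa xb]]; [lia | exact: fg].
Qed.

(** Summing over the points of [s] instead of those of the conjugate leaves only the terms at [a]
    and [b] to be compared, by [sum_two]. *)
Let arcs_in_conj (u : 'S_n) i j : arcs_in (s ^ u)%g i j =
  \sum_x [&& i <= u x, u x < u (s x) & u (s x) < j].
Proof.
by rewrite /arcs_in (reindex_inj (@perm_inj _ u)); apply: eq_bigr => x _; rewrite !permJ.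
Qed.

(** Write [c = s a] and [d = s b]. The crossing arcs [(a, c)], [(b, d)] become the disjoint arcs
    [(a, b)], [(c, d)] under the inner move and the nested arcs [(b, c)], [(a, d)] under the outer
    one. If [b] is unmatched, then [c], respectively [a], becomes unmatched instead. *)
Definition inner_move : 'S_n := (s ^ tperm b (s a))%g.
Definition outer_move : 'S_n := (s ^ tperm a b)%g.

(** The two correction terms are the intervals that contain [(a, b)] but not [(a, s a)], and those
    that contain [(s a, s b)] but not [(b, s b)]. *)
Lemma arcs_in_inner_move i j : arcs_in inner_move i j = arcs_in s i j +
  ([&& i <= a, b < j & j <= s a] + [&& s a < s b, b < i, i <= s a & s b < j]).
Proof.
rewrite arcs_in_conj; apply: sum_two => [x xa xb|].
  have [->|xc] := eqVneq x (s a).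
    by rewrite sK tpermR tpermD ?ord_eqE; lia.
  have [->|xd] := eqVneq x (s b).
    rewrite sK tpermL; have [->|nbb] := eqVneq (s b) b; first by rewrite tpermL; lia.
    by rewrite tpermD ?(inj_eq perm_inj) // 1?eq_sym //; rewrite ?ord_eqE; lia.
  rewrite !tpermD // 1?eq_sym ?(inj_eq perm_inj) //.
  by apply: contraNneq xd => <-; rewrite sK.
rewrite tpermR tpermL tpermD ?ord_eqE; try lia.
have [e|nbb] := eqVneq (s b) b; first by rewrite e tpermL; lia.
by move: obd; rewrite (negPf nbb) /= => obd'; rewrite tpermD ?ord_eqE; lia.
Qed.

Lemma arcs_in_outer_move i j : arcs_in outer_move i j = arcs_in s i j +
  [&& a < i, i <= b, s a < j & (s b == b) || (j <= s b)].
Proof.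
rewrite arcs_in_conj; apply: sum_two => [x xa xb|].
  have [->|xc] := eqVneq x (s a).
    by rewrite sK tpermL tpermD ?ord_eqE; lia.
  have [->|xd] := eqVneq x (s b).
    rewrite sK tpermR; have [->|nbb] := eqVneq (s b) b; first by rewrite tpermR; lia.
    move: obd; rewrite (negPf nbb) /= => obd'; rewrite tpermD ?ord_eqE; lia.
  rewrite !tpermD // 1?eq_sym //.
    by apply: contraNneq xc => <-; rewrite sK.
  by apply: contraNneq xd => <-; rewrite sK.
rewrite tpermR tpermL tpermD ?ord_eqE; try lia.
have [e|nbb] := eqVneq (s b) b; first by rewrite e tpermR; lia.
by move: obd; rewrite (negPf nbb) /= => obd'; rewrite tpermD ?ord_eqE; lia.
Qed.

(** The move exchanges the roles of [a] and [b], neither of which is a closer before or after it,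
    and the old right ends still have partners to their left. *)
Lemma outer_move_closers x : (outer_move x < x) = (s x < x).
Proof.
have [y ->] : exists y, x = tperm a b y by exists (tperm a b x); rewrite tpermK.
rewrite permJ.
have [->|ya] := eqVneq y a.
  rewrite tpermL tpermD ?ord_eqE; try lia.
  by move: obd; rewrite ord_eqE; lia.
have [->|yb] := eqVneq y b.
  rewrite tpermR; have [e|nbb] := eqVneq (s b) b; first by rewrite e tpermR; lia.
  by move: obd; rewrite (negPf nbb) /= => obd'; rewrite tpermD ?ord_eqE; lia.
rewrite ![tperm a b y]tpermD 1?eq_sym //.
have [->|yc] := eqVneq y (s a); first by rewrite sK tpermL; lia.
have [e|yd] := eqVneq y (s b).
  by move: obd yb; rewrite e sK tpermR !ord_eqE; lia.
by rewrite tpermD //; [apply: contraNneq yc|apply: contraNneq yd] => ->; rewrite sK.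
Qed.

Lemma moves_below t : involutive t -> planar t -> arcs_le s t ->
  arcs_le inner_move t \/ arcs_le outer_move t.
Proof.
move=> tK plt le_st; apply: contrapT => /not_orP[].
move=> /existsNP[i0 /existsNP[j0 /negP blk0]] /existsNP[i1 /existsNP[j1 /negP blk1]].
have := le_st i0 j0; have := le_st i1 j1.
move: blk0 blk1; rewrite arcs_in_inner_move arcs_in_outer_move -!ltnNge => blk0 blk1 le1 le0.
have [in1 e1] : [&& a < i1, i1 <= b, s a < j1 & (s b == b) || (j1 <= s b)] /\
    arcs_in s i1 j1 = arcs_in t i1 j1 by lia.
rewrite ord_eqE in in1.
(* The interval where the inner move fails contains either [(a, b)] but not [s a], or [(s a, s b)]
   but not [b]. In the first case the arc at [a] joins the outer parts and [b] is the point of the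
   middle with no partner in the span; in the second case these are the arc at [b] and the point
   [s a]. *)
have [in0|in2] : [&& i0 <= a, b < j0 & j0 <= s a] \/
    [&& s a < s b, b < i0, i0 <= s a & s b < j0] by lia.
- by refine (@tight_overlap s t sK tK le_st i0 i1 j0 j1 a b plt _ _ _ _ _ _ _ _);
    rewrite ?ord_eqE; lia.
- by refine (@tight_overlap s t sK tK le_st i1 i0 j1 j0 b (s a) plt _ _ _ _ _ _ _ _);
    rewrite ?sK ?ord_eqE; lia.
Qed.

Lemma arcs_in_moves (u : 'S_n) : u = inner_move \/ u = outer_move ->
  arcs_le s u /\ \sum_(i < n.+1) \sum_(j < n.+1) arcs_in s i j <
                 \sum_(i < n.+1) \sum_(j < n.+1) arcs_in u i j.
Proof.
move=> defu; have le_su : arcs_le s u.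
  by case: defu => -> i j; rewrite ?arcs_in_inner_move ?arcs_in_outer_move leq_addr.
split=> //.
(* The inner move adds an arc to [[a, s a)], namely [(a, b)]; the outer move adds [(b, s a)] to
   [[b, s a + 1)]. *)
have [i [j lt_ij]] : exists (i j : 'I_n.+1), arcs_in s i j < arcs_in u i j.
  case: defu => ->.
    have lta := leqW (ltn_ord a); have ltsa := leqW (ltn_ord (s a)).
    by exists (Ordinal lta), (Ordinal ltsa); rewrite arcs_in_inner_move /=; lia.
  have ltb := leqW (ltn_ord b); have ltsa : (s a).+1 < n.+1 by rewrite ltnS.
  exists (Ordinal ltb), (Ordinal ltsa); rewrite arcs_in_outer_move /=.
  by move: obd; lia.
rewrite (bigD1 i) //= [ltnRHS](bigD1 i) //= -addSn leq_add //; last first.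
  by apply: leq_sum => x _; apply: leq_sum => y _; exact: le_su.
rewrite (bigD1 j) //= [ltnRHS](bigD1 j) //= -addSn leq_add //.
by apply: leq_sum => y _; exact: le_su.
Qed.

End Moves.

Definition arc_weight s : nat := \sum_(i < n.+1) \sum_(j < n.+1) arcs_in s i j.

Lemma arc_weight_le s : arc_weight s <= n.+1 * (n.+1 * n).
Proof.
rewrite /arc_weight -[X in X * (_ * _)]card_ord -sum_nat_const leq_sum // => i _.
rewrite -[X in X * _]card_ord -sum_nat_const leq_sum // => j _; exact: arcs_in_le.
Qed.

Lemma planar_or_obstruction s : involutive s ->
  planar s \/ exists a b, obstruction s a b.
Proof.
move=> sK; have [/existsP[a /existsP[b ob]]|/existsPn nob] :=
  boolP [exists a, exists b, obstruction s a b].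
  by right; exists a, b.
by left; apply: planarP => // a b; have /existsPn := nob a; exact.
Qed.

(** Both moves increase [arc_weight], which is bounded, so repeated moves end at a planar matching.
    The induction runs on the distance of the weight to its bound. *)
Lemma moves_ind (P : 'S_n -> Prop) :
  (forall s, involutive s -> planar s -> P s) ->
  (forall s, involutive s -> (exists a b, obstruction s a b) ->
     (forall t, involutive t -> arc_weight s < arc_weight t -> P t) -> P s) ->
  forall s, involutive s -> P s.
Proof.
move=> Ppl Pmove s; have [k] := ubnP (n.+1 * (n.+1 * n) - arc_weight s).
elim: k s => // k IHk s lek sK.
have [pl|ob] := planar_or_obstruction sK; first exact: Ppl.
apply: Pmove => // t tK lt_st; apply: IHk => //.
by have := arc_weight_le t; lia.
Qed.

(* A planar t above s matches everything below an arc of s, because s does. *)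
Lemma arcs_le_closers s t : involutive s -> involutive t ->
  planar s -> planar t -> arcs_le s t -> forall b, s b < b -> t b < b.
Proof.
move=> sK tK pls plt le_st b sbb.
have in_s (x : 'I_n) : s b <= x <= b -> [&& s x != x, s b <= s x & s x <= b].
  have [->|xb] := eqVneq x b; first by rewrite ord_eqE; lia.
  have [->|xsb] := eqVneq x (s b); first by rewrite sK ord_eqE; lia.
  move: xb xsb; rewrite !ord_eqE => xb xsb /andP[sbx le_xb].
  have [||-> h1] := pls (s b) x; rewrite ?sK; lia.
have all_t : forall x : 'I_n, s b <= x <= b -> [&& t x != x, s b <= t x & t x <= b].
  move=> x in_x; apply: contraT => out_x.
  have := arcs_in_matched (s b) b.+1 sK; have := arcs_in_matched (s b) b.+1 tK.
  have := le_st (s b) b.+1.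
  suff : \sum_(x < n) [&& s b <= x, x < b.+1, t x != x, s b <= t x & t x < b.+1] <
         \sum_(x < n) [&& s b <= x, x < b.+1, s x != x, s b <= s x & s x < b.+1].
    by rewrite -!addnn; lia.
  rewrite (bigD1 x) //= [ltnRHS](bigD1 x) //= -addSn leq_add //.
    by have := in_s x in_x; lia.
  by apply: leq_sum => y _; case: (boolP (s b <= y <= b)) => [/in_s|]; lia.
have := all_t b; rewrite ord_eqE; lia.
Qed.

(** Closers are treated from left to right. If the partners of [b] differed, the inner one would be
    an opener under the arc of the other matching, hence by planarity matched there to an earlier
    closer, on which the two matchings already agree. *)
Lemma planar_closers_inj s t : involutive s -> involutive t ->
  planar s -> planar t -> (forall b, (s b < b) = (t b < b)) -> s = t.
Proof.
move=> sK tK pls plt eqc.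
have key (u v : 'S_n) b : involutive u -> involutive v -> planar u ->
   (forall x : 'I_n, (u x < x) = (v x < x)) ->
   (forall x : 'I_n, x < b -> u x < x -> u x = v x) -> u b < b -> v b <= u b.
  move=> uK vK plu eqcl IH ubb; rewrite leqNgt; apply/negP => lt_uv.
  have vbb : v b < b by rewrite -eqcl.
  have [||nfix lo hi] := plu (u b) (v b); rewrite ?uK //; rewrite uK in hi.
  have opn : v b < u (v b).
    have := eqcl (v b); rewrite vK ltnNge; move: nfix; rewrite ord_eqE; lia.
  have e : v b = v (u (v b)) by rewrite -[RHS]IH ?uK.
  have eb : b = u (v b) := @perm_inj _ v _ _ e.
  by rewrite -eb ltnn in hi.
have cl b : s b < b -> s b = t b.
  have [k] := ubnP b; elim: k b => // k IHk b lek sbb; apply: val_inj => /=.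
  have IH (x : 'I_n) : x < b -> s x < x -> s x = t x by move=> xb; apply: IHk; lia.
  apply/eqP; rewrite eqn_leq; apply/andP; split.
    apply: (key t s) => //; [by move=> x xb txx; rewrite IH // eqc|by rewrite -eqc].
  exact: (key s t).
apply/permP => b; case: (ltngtP (s b) b) => [/cl //|lt_b|/val_inj e].
  have := cl (s b); rewrite sK => /(_ lt_b) e.
  by rewrite {2}e tK.
rewrite e; case: (ltngtP (t b) b) => [|lt_b|/val_inj //].
  by rewrite -eqc e ltnn.
have := eqc (t b); rewrite tK lt_b => h.
by have := cl (t b); rewrite h tK => /(_ isT) /(canRL sK); rewrite e => ->.
Qed.

End Matchings.

(** * Outer arcs *)

Section OuterArcs.
Local Open Scope nat_scope.
Variable n : nat.
Implicit Types (s t : 'S_n) (a b c q : 'I_n).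

Definition outer_arc t q : bool :=
  (q < t q) && [forall c : 'I_n, (c < q) ==> (t c <= t q)].

Definition remove_arc t q : 'S_n := (t * tperm q (t q))%g.

Lemma remove_arcE t q x : involutive t ->
  remove_arc t q x = if (x == q) || (x == t q) then x else t x.
Proof.
move=> tK; rewrite permM; have [->|xq] := eqVneq x q; first by rewrite tpermR.
have [->|xtq] /= := eqVneq x (t q); first by rewrite tK tpermL.
rewrite tpermD // 1?eq_sym ?(inj_eq perm_inj) //.
by apply: contraNneq xtq => <-; rewrite tK.
Qed.

Lemma remove_arc_involutive t q : involutive t -> involutive (remove_arc t q).
Proof.
move=> tK x; rewrite [remove_arc t q x]remove_arcE //.
case: ifP => [xq|/norP[xq xtq]]; rewrite remove_arcE // ?xq //.
rewrite (inj_eq perm_inj) (can2_eq tK tK) tK.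
by rewrite (negPf xq) (negPf xtq).
Qed.

Lemma arcs_in_remove t q i j : involutive t -> q < t q ->
  arcs_in t i j = arcs_in (remove_arc t q) i j + ((i <= q) && (t q < j)).
Proof.
move=> tK qtq; rewrite /arcs_in (bigD1 q) //= [in RHS](bigD1 q) //=.
rewrite remove_arcE // eqxx ltnn andbF add0n qtq /= addnC; congr (_ + _).
apply: eq_bigr => x xq; rewrite remove_arcE // (negPf xq) /=.
case: eqP => [->|//]; rewrite tK; lia.
Qed.

(** Outerness matters here: the ends of an arc nested in another one would become unmatched points
    below an arc. *)
Lemma remove_arc_planar t q : involutive t -> planar t -> outer_arc t q ->
  planar (remove_arc t q).
Proof.
move=> tK plt /andP[qtq /forallP outq] a b ab.
rewrite remove_arcE //; case: ifP => [_|/norP[aq atq] bta]; first by lia.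
have [btb lo hi] := plt _ _ ab bta; rewrite remove_arcE //.
case: ifP => [/orP[/eqP bq|/eqP btq]|//]; exfalso.
  by have := outq a; rewrite bq in ab bta hi *; rewrite ab /=; lia.
by have := outq a; rewrite btq tK in bta lo hi *; rewrite lo /=; lia.
Qed.

(** Among the arcs covering [m], take the one with the smallest left end: an arc that starts further
    left and ends further right would cover [m] too. *)
Lemma outer_arc_above t m : involutive t -> t m != m ->
  exists q, [/\ outer_arc t q, q <= m & m <= t q].
Proof.
move=> tK tmm.
have [a am] : exists a, [&& a < t a, a <= m & m <= t a].
  case: (ltngtP m (t m)) => [lt_m|lt_m|/val_inj e]; last by rewrite -e eqxx in tmm.
    by exists m; rewrite lt_m leqnn ltnW.
  by exists (t m); rewrite tK lt_m leqnn ltnW.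
case: (@arg_minnP _ a (fun a => [&& a < t a, a <= m & m <= t a])
  (fun a : 'I_n => val a) am) => q /and3P[qtq qm mtq] minq.
exists q; split=> //; rewrite /outer_arc qtq; apply/forallP => c.
apply/implyP => cq; rewrite leqNgt; apply/negP => tqtc.
by have := minq c; rewrite /=; lia.
Qed.

(* If removing any outer arc of t breaks the inequality, every outer arc lies
   below a tight interval, and the tight prefixes [0, e) can be extended step
   by step up to e = n. *)
Lemma arcs_le_remove s t : involutive s -> involutive t -> planar t ->
  arcs_le s t -> arcs_in s 0 n < arcs_in t 0 n ->
  exists2 q, outer_arc t q & arcs_le s (remove_arc t q).
Proof.
move=> sK tK plt le_st lt_st; apply: contrapT => none.
have tight q : outer_arc t q -> exists i j, [/\ i <= q, t q < j &
    arcs_in s i j = arcs_in t i j].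
  move=> outq; apply: contrapT => notight; apply: none; exists q => // i j.
  have [qtq _] := andP outq; have := arcs_in_remove i j tK qtq.
  have := le_st i j; case: (boolP ((i <= q) && (t q < j))) => [/andP[iq tqj]|] /=.
    have [e|] := eqVneq (arcs_in s i j) (arcs_in t i j); last by lia.
    by case: notight; exists i, j.
  by lia.
(* Interval bounds are arbitrary naturals, so a tight prefix may overshoot [n]; the counts do not
   see the excess. *)
have cap (u : 'S_n) j : arcs_in u 0 j = arcs_in u 0 (minn j n).
  by rewrite /arcs_in; apply: eq_bigr => a _; have := ltn_ord (u a); lia.
have prefix m : m <= n -> exists2 e, m <= e & arcs_in s 0 e = arcs_in t 0 e.
  elim: m => [|m IHm] le_mn.
    exists 0 => //.
    by rewrite /arcs_in !big1 // => a _; rewrite !ltn0 !andbF.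
  have [e le_me tight_e] := IHm (ltnW le_mn).
  have [|le_em] := ltnP m e; first by exists e.
  have em : e = m by lia.
  rewrite em in tight_e.
  pose b := Ordinal le_mn.
  have [fixb|movb] := eqVneq (t b) b.
    exists m.+1 => //; apply/eqP; rewrite eqn_leq le_st /=.
    have := leq_arcs_in s (leqnn 0) (leqnSn m).
    suff : arcs_in t 0 m.+1 = arcs_in t 0 m by lia.
    rewrite !arcs_in_closers //; apply: eq_bigr => x _.
    have [->|xb] := eqVneq x b; first by rewrite fixb; lia.
    by move: xb; rewrite ord_eqE /=; lia.
  have [q [outq qb btq]] := outer_arc_above tK movb.
  have [i [j [iq tqj tight_ij]]] := tight q outq.
  rewrite /= in qb btq.
  exists j; first by lia.
  have im : i <= m by lia.
  have mj : m <= j by lia.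
  (* The tight intervals [[0, m)] and [[i, j)] have the union [[0, j)], which is tight as soon as no
     arc of [t] joins [[0, i)] to [[m, j)]. Such an arc would start before [q] and, [q] being outer,
     end no later than [t q], whereas planarity puts [t q] below it. *)
  have es := arcs_in_span s (leq0n i) im mj.
  have et := arcs_in_span t (leq0n i) im mj.
  have nocross : \sum_(a < n) [&& 0 <= a, a < i, m <= t a & t a < j] = 0.
    apply: big1 => a _; apply/eqP; rewrite eqb0; apply/negP => /and4P[_ ai mta taj].
    have [qtq /forallP outq'] := andP outq.
    have aq : a < q by lia.
    have := outq' a; rewrite aq /= => tatq.
    have [ta|ne] := eqVneq (t a) q.
      by move: qtq; rewrite -ta tK; lia.
    have [ta|ne'] := eqVneq (t a) (t q).
      by move: aq; rewrite (perm_inj ta) ltnn.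
    have [||_ _] := plt a q; rewrite ?ord_eqE /= in ne ne' *; lia.
  by have := le_st 0 j; have := le_st i m; lia.
have [e le_ne tight_e] := prefix n (leqnn n).
have en : minn e n = n by lia.
by move: tight_e lt_st; rewrite !(cap _ e) en => ->; rewrite ltnn.
Qed.

End OuterArcs.

(** * Tableaux and planar matchings *)

Section TwoColumns.
Local Open Scope nat_scope.

Local Notation col1 T := (nth [::] T 0).
Local Notation col2 T := (nth [::] T 1).

Lemma two_column_facts n T : two_column_tableaux n T ->
  [/\ perm_eq (col1 T ++ col2 T) (iota 1 n), sorted ltn (col1 T),
      sorted ltn (col2 T), size (col2 T) <= size (col1 T)
    & forall r, r < size (col2 T) -> nth 0 (col1 T) r < nth 0 (col2 T) r]
  /\ T = [seq c <- [:: col1 T; col2 T] | c != [::]].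
Proof.
move=> [[nilT shT permT /allP sortT rowT] sizeT].
have srt c : sorted ltn (nth [::] T c).
  have [le_c|lt_c] := leqP (size T) c; first by rewrite nth_default.
  by rewrite sortT // mem_nth.
split.
  split=> // [| |r /(rowT 0 r)//].
    by move: permT; case: (T) sizeT => [|c [|d [|]]] //= _; rewrite ?cats0.
  move: shT; case: (T) sizeT => [|c [|d [|]]] //= _; by rewrite andbT.
by move: nilT; case: (T) sizeT => [|c [|d [|]]] //= _; rewrite !inE ?negb_or eq_sym;
  [|rewrite [[::] == d]eq_sym => /andP[-> ->]//] => ->.
Qed.

Section TableauMatching.
Variables (n : nat) (T : tableau).
Hypothesis hT : two_column_tableaux n T.
Implicit Types (s : 'S_n) (a b c : 'I_n).

Let op := col1 T.
Let cl := col2 T.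

Definition has_closers s : Prop := forall b, (s b < b) = (b.+1 \in col2 T).

Let perm_oc : perm_eq (op ++ cl) (iota 1 n).
Proof. by case: (two_column_facts hT) => -[]. Qed.
Let cl_row r : r < size cl -> nth 0 op r < nth 0 cl r.
Proof. by case: (two_column_facts hT) => -[_ _ _ _ h] _; exact: h. Qed.
Let cl_size : size cl <= size op.
Proof. by case: (two_column_facts hT) => -[]. Qed.
Let cl_sorted : sorted ltn cl.
Proof. by case: (two_column_facts hT) => -[]. Qed.
Let op_sorted : sorted ltn op.
Proof. by case: (two_column_facts hT) => -[]. Qed.
Let op_cl x : (x \in op) = (1 <= x <= n) && (x \notin cl).
Proof.
have := perm_mem perm_oc x; rewrite mem_cat mem_iota add1n ltnS => <-.
have : uniq (op ++ cl) by rewrite (perm_uniq perm_oc) iota_uniq.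
rewrite cat_uniq => /and3P[_ /hasPn dis _].
by have [/dis/negPf->|] //= := boolP (x \in cl); rewrite ?orbF ?andbT.
Qed.
Let cl_range x : x \in cl -> 1 <= x <= n.
Proof.
move=> xcl; have := perm_mem perm_oc x.
by rewrite mem_cat mem_iota add1n ltnS xcl orbT => <-.
Qed.

(** Joining the two entries of each row gives a first matching with the right closers, in general
    not a planar one. *)
Let row_partner x : nat :=
  if x \in cl then nth 0 op (index x cl)
  else if index x op < size cl then nth 0 cl (index x op) else x.

Let row_partner_op x : x \notin cl -> 1 <= x <= n -> index x op < size cl ->
  [/\ row_partner x \in cl, x < row_partner x & row_partner (row_partner x) = x].
Proof.
move=> xcl xn lt_i; rewrite /row_partner (negPf xcl) lt_i mem_nth //.
have xop : x \in op by rewrite op_cl xn.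
rewrite index_uniq ?nth_index // ?(sorted_uniq ltn_trans ltnn) //.
by split=> //; rewrite -{1}[x](nth_index 0 xop) cl_row.
Qed.

Let row_partner_cl x : x \in cl ->
  [/\ row_partner x \in op, row_partner x < x & row_partner (row_partner x) = x].
Proof.
move=> xcl; have lt_i : index x cl < size cl by rewrite index_mem.
have lt_o : index x cl < size op by apply: leq_trans cl_size.
have opP : nth 0 op (index x cl) \in op by rewrite mem_nth.
have -> : row_partner x = nth 0 op (index x cl) by rewrite /row_partner xcl.
split=> //; first by rewrite -{2}[x](nth_index 0 xcl) cl_row.
rewrite /row_partner; have := opP; rewrite op_cl => /andP[_ /negPf ->].
by rewrite index_uniq ?lt_i ?nth_index // (sorted_uniq ltn_trans ltnn).
Qed.

Let row_partner_fix x : x \notin cl -> size cl <= index x op -> row_partner x = x.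
Proof. by rewrite /row_partner => /negPf ->; rewrite leqNgt => /negPf ->. Qed.

Let row_partner_range x : 1 <= x <= n -> 1 <= row_partner x <= n.
Proof.
move=> xn; have [xcl|xcl] := boolP (x \in cl).
  by have [+ _ _] := row_partner_cl xcl; rewrite op_cl => /andP[].
have [lt_i|le_i] := ltnP (index x op) (size cl).
  by have [/cl_range] := row_partner_op xcl xn lt_i.
by rewrite row_partner_fix.
Qed.

Let row_partnerK x : 1 <= x <= n -> row_partner (row_partner x) = x.
Proof.
move=> xn; have [xcl|xcl] := boolP (x \in cl).
  by have [] := row_partner_cl xcl.
have [lt_i|le_i] := ltnP (index x op) (size cl).
  by have [] := row_partner_op xcl xn lt_i.
by rewrite !row_partner_fix.
Qed.

Lemma matching_exists : exists2 s : 'S_n, involutive s & has_closers s.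
Proof.
pose f (b : 'I_n) : 'I_n := insubd b (row_partner b.+1).-1.
have rng (b : 'I_n) : 1 <= row_partner b.+1 <= n.
  by apply: row_partner_range; rewrite /= ltn_ord.
have fE (b : 'I_n) : (f b).+1 = row_partner b.+1.
  have := rng b; rewrite /f val_insubd => /andP[h1 h2].
  by rewrite (_ : _ < n) ?prednK //; lia.
have fK : involutive f.
  move=> b; apply: val_inj; apply: succn_inj; rewrite /= !fE row_partnerK //.
  by rewrite /= ltn_ord.
exists (perm (inv_inj fK)) => b; first by rewrite !permE.
rewrite permE -ltnS fE; have [bcl|bcl] := boolP (b.+1 \in cl).
  by have [_ ->] := row_partner_cl bcl.
have bn : 1 <= b.+1 <= n by rewrite /= ltn_ord.
have [lt_i|le_i] := ltnP (index b.+1 op) (size cl).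
  by have [_ h _] := row_partner_op bcl bn lt_i; rewrite ltnNge ltnW.
by rewrite row_partner_fix // ltnn.
Qed.

(** Outer moves make the row matching planar without changing its closers. *)
Lemma planar_matching_exists :
  exists s : 'S_n, [/\ involutive s, planar s & has_closers s].
Proof.
have [s sK scl] := matching_exists.
elim/moves_ind: s / sK scl => s sK => [pl scl|[a [b ob]] IHs scl].
  by exists s.
have [] := arcs_in_moves sK ob (or_intror erefl) => _ lt_w.
apply: (IHs _ _ lt_w); first exact: conj_involutive.
by move=> x; rewrite outer_move_closers.
Qed.

Section Sigma.
Variable s : 'S_n.
Hypotheses (sK : involutive s) (pl : planar s) (scl : has_closers s).

(* Planarity: the partner of a closer j is the last entry before j of the first
   column that is not yet matched. *)
Lemma sigma_rest_mem (pre js used : seq nat) a b : cl = pre ++ js ->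
  (forall x : 'I_n, (x.+1 \in used) = (x < s x) && ((s x).+1 \in pre)) ->
  ((a.+1, b.+1) \in sigma_rest op used js) = (b.+1 \in js) && (s b == a).
Proof.
elim: js pre used => [//|j js IHjs] pre used ecl eused.
have jcl : j \in cl by rewrite ecl mem_cat inE eqxx orbT.
have [c ej] : exists c : 'I_n, j = c.+1.
  have := cl_range jcl; case: (j) => [//|k] kn; by exists (Ordinal kn).
have scc : s c < c by rewrite scl -ej.
have sorted_cl : sorted ltn (pre ++ j :: js) by rewrite -ecl.
have pre_lt x : x \in pre -> x < j.
  move: sorted_cl; rewrite sorted_pairwise; last exact: ltn_trans.
  rewrite pairwise_cat => /and3P[/allrelP lt _ _] xpre.
  exact: (lt x j xpre (mem_head j js)).
have lt_pre x : x \in cl -> x < j -> x \in pre.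
  move: sorted_cl; rewrite ecl mem_cat sorted_pairwise; last exact: ltn_trans.
  rewrite pairwise_cat => /and3P[_ _ /= /andP[/allP gt _]].
  by case/orP=> //; rewrite inE => /predU1P[->|/gt /= jx xj]; lia.
have opE (x : 'I_n) : (x.+1 \in op) = ~~ (s x < x).
  by rewrite op_cl /= ltn_ord scl.
(* A larger entry of the first column before [j] lies under the arc [(s c, c)]. By planarity its
   partner is an earlier closer, so this entry has been used already. *)
have maxE : \max_(d <- op | (d \notin used) && (d < j)) d = (s c).+1.
  apply/eqP; rewrite eqn_leq; apply/andP; split.
    apply/bigmax_leqP_seq => d dop /andP[dused dj].
    have dn : 1 <= d <= n by move: dop; rewrite op_cl => /andP[].
    have [e ed] : exists e : 'I_n, d = e.+1.
      by case: (d) dn => [//|k] kn; exists (Ordinal kn).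
    rewrite ed leqNgt; apply/negP; rewrite ltnS => sce.
    have [|nfix lo hi] := pl sce; first by rewrite sK; lia.
    rewrite sK in hi.
    have ese : e < s e.
      move: dop; rewrite ed opE -leqNgt leq_eqVlt => /predU1P[/val_inj e'|//].
      by rewrite -e' eqxx in nfix.
    move: dused; rewrite ed eused ese lt_pre //; first by rewrite -scl sK.
    by rewrite ej.
  apply: (@leq_bigmax_seq _ op (fun d => (d \notin used) && (d < j)) id).
    by rewrite opE sK -leqNgt ltnW.
  rewrite eused sK -ej ej ltnS scc andbT.
  apply/negP => /andP[_ /pre_lt]; by rewrite ej ltnn.
rewrite /= maxE inE (IHjs (rcons pre j) _ _); last 2 first.
- by rewrite cat_rcons.
- move=> x;  rewrite inE eused mem_rcons inE eqSS.
  have [->|xsc] := eqVneq x (s c); first by rewrite sK -ej !eqxx scc.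
  rewrite (_ : (x == s c :> nat) = false) /=; last exact/negbTE.
  congr (_ && _); rewrite ej eqSS; case: eqVneq => //= e.
  by case/eqP: xsc; rewrite -(val_inj e) sK.
rewrite ej -pair_eqE /= !eqSS inE eqSS.
have [e|ne] := eqVneq b c.
  rewrite e /= -ej; have /negPf -> : j \notin js.
    have := sorted_uniq ltn_trans ltnn sorted_cl.
    by rewrite cat_uniq /= => /and4P[].
  by rewrite !eqxx andbT !orbF /=; apply: eq_sym.
by rewrite (_ : (b == c :> nat) = false) ?andbF //; apply/negbTE.
Qed.

Lemma sigma_mem a b : ((a.+1, b.+1) \in sigma T) = (a < b) && (s b == a).
Proof.
rewrite /sigma; change (nth [::] T 0) with op; change (nth [::] T 1) with cl.
have -> : (a < b) && (s b == a) = (b.+1 \in cl) && (s b == a).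
  by rewrite -scl; case: eqP => [->|]; rewrite ?andbF.
case ecl: cl => [//|j js].
have jcl : j \in cl by rewrite ecl inE eqxx.
have [c ej] : exists c : 'I_n, j = c.+1.
  have := cl_range jcl; case: (j) => [//|k] kn; by exists (Ordinal kn).
have scc : s c < c by rewrite scl -ej.
have j_min (x : 'I_n) : x.+1 \in cl -> j <= x.+1.
  rewrite ecl inE => /predU1P[->//|xjs]; move: cl_sorted.
  rewrite ecl /= path_sortedE; last exact: ltn_trans.
  by case/andP => /allP/(_ _ xjs)/ltnW.
(* Otherwise the point just before [c] would be matched under the first arc, to its left, and so be
   a closer smaller than the first one. *)
have scE : j.-1 = (s c).+1.
  rewrite ej /=; apply/eqP; rewrite eqn_leq scc andbT leqNgt; apply/negP => sc_lt.
  have kn : c.-1 < n by have := ltn_ord c; lia.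
  pose e := Ordinal kn.
  have [||nfix lo hi] := pl (a := s c) (b := e); rewrite ?sK /=; try lia.
  rewrite sK in hi.
  have see : s e < e.
    by rewrite ltn_neqAle; rewrite -[s e == e :> nat]/(s e == e) nfix /=; lia.
  have : e.+1 \in cl by rewrite -scl.
  by move/j_min; rewrite ej /=; lia.
(* The separately defined first pair is the one that the general rule produces when nothing is used
   yet. *)
have e0 : sigma_rest op [::] cl = (j.-1, j) :: sigma_rest op [:: j.-1] js.
  rewrite ecl /=; suff -> : \max_(d <- op | (d \notin [::]) && (d < j)) d = j.-1 by [].
  apply/eqP; rewrite eqn_leq; apply/andP; split.
    by apply/bigmax_leqP_seq => d _ /=; lia.
  apply: (@leq_bigmax_seq _ op (fun d => (d \notin [::]) && (d < j)) id).
    by rewrite scE op_cl /= ltn_ord -scl sK -leqNgt ltnW.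
  by rewrite /= ej.
rewrite -e0 (@sigma_rest_mem [::] cl) // ?ecl // => x.
by rewrite andbF.
Qed.

End Sigma.
End TableauMatching.

(** * The tableau of a matching *)

Section MatchingTableau.
Variable n : nat.
Implicit Types (s : 'S_n) (a b c : 'I_n).

Definition points (p : pred 'I_n) : seq nat :=
  [seq (val b).+1 | b <- enum 'I_n & p b].

Definition matching_tableau s : tableau :=
  [seq c <- [:: points (fun b => ~~ (s b < b)); points (fun b => s b < b)]
     | c != [::]].

Definition two_column_shape (m r : nat) : seq nat :=
  [seq x <- [:: m - r; r] | x != 0].

Lemma mem_points (p : pred 'I_n) b : (b.+1 \in points p) = p b.
Proof.
apply/mapP/idP => [[c]|pb]; last by exists b => //; rewrite mem_filter pb mem_enum.
by rewrite mem_filter mem_enum => /andP[pc _] [] /val_inj ->.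
Qed.

Lemma points_sorted p : sorted ltn (points p).
Proof.
rewrite sorted_map; apply: sorted_filter => [a b c|]; first exact: ltn_trans.
have := iota_ltn_sorted 0 n; rewrite -val_enum_ord sorted_map.
by apply: sub_sorted => a b.
Qed.

Lemma sorted_points (p : pred 'I_n) (c : seq nat) : sorted ltn c ->
  (forall x, x \in c -> 1 <= x <= n) -> (forall b, (b.+1 \in c) = p b) ->
  c = points p.
Proof.
move=> srt rng mem; apply: (irr_sorted_eq ltn_trans ltnn srt (points_sorted p)).
move=> x; apply/idP/idP => xin.
  have := rng x xin; case: x xin => [//|x] xin xn.
  by have := mem_points p (Ordinal xn); rewrite -mem /= xin.
have /mapP[b _ xb] := xin; by move: xin; rewrite xb mem_points mem.
Qed.

Lemma count_points p i :
  count (fun x => x <= i) (points p) = \sum_(b < n) (p b && (b < i)).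
Proof.
rewrite /points count_map count_filter -sum1_count big_mkcond /= big_enum /=.
by apply: eq_bigr => b _; rewrite andbC; case: (_ && _).
Qed.

Lemma shape_filter (c d : seq nat) :
  Defs.shape [seq e <- [:: c; d] | e != [::]] = [seq x <- [:: size c; size d] | x != 0].
Proof. by case: c => [|? ?]; case: d. Qed.

Lemma subtableau_shape i (c d : seq nat) :
  Defs.shape (subtableau i [seq e <- [:: c; d] | e != [::]]) =
  [seq x <- [:: count (fun x => x <= i) c; count (fun x => x <= i) d] | x != 0].
Proof.
rewrite -!size_filter -shape_filter; congr Defs.shape; rewrite /subtableau.
by case: c => [|x c]; case: d.
Qed.

(** An arc lies in [[0, i)] as soon as its right end does, so the entries up to [i] of the second
    column count these arcs. *)
Lemma matching_shape s i : involutive s -> i <= n ->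
  Defs.shape (subtableau i (matching_tableau s)) = two_column_shape i (arcs_in s 0 i).
Proof.
move=> sK le_in; rewrite subtableau_shape !count_points /two_column_shape.
have e : arcs_in s 0 i = \sum_(b < n) ((s b < b) && (b < i)).
  by rewrite arcs_in_closers //; apply: eq_bigr => b _; rewrite leq0n.
rewrite e (_ : \sum_(b < n) (~~ (s b < b) && (b < i)) =
               i - \sum_(b < n) ((s b < b) && (b < i))) //.
suff : \sum_(b < n) (~~ (s b < b) && (b < i)) + \sum_(b < n) ((s b < b) && (b < i)) = i.
  by lia.
rewrite -big_split /= -[RHS]subn0 -(ord_card_interval (leq0n i) le_in).
by apply: eq_bigr => b _; case: (s b < b); rewrite //= addn0.
Qed.

Lemma matching_shape_full s : involutive s ->
  Defs.shape (matching_tableau s) = two_column_shape n (arcs_in s 0 n).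
Proof.
move=> sK; rewrite -matching_shape // subtableau_shape shape_filter.
have all_le p : count (fun x => x <= n) (points p) = size (points p).
  by apply/eqP; rewrite -all_count; apply/allP => x /mapP[b _ ->] /=.
by rewrite !all_le.
Qed.

Lemma two_column_closers T s : two_column_tableaux n T -> has_closers T s ->
  T = matching_tableau s.
Proof.
move=> hT scl; have [[perm_oc op_s cl_s _ _] ->] := two_column_facts hT.
have rng x : x \in col1 T ++ col2 T -> 1 <= x <= n.
  by rewrite (perm_mem perm_oc) mem_iota add1n ltnS.
have uniq_oc : uniq (col1 T ++ col2 T) by rewrite (perm_uniq perm_oc) iota_uniq.
congr [seq c <- [:: _; _] | _].
  apply: sorted_points => // [x xc|b]; first by rewrite rng // mem_cat xc.
  rewrite scl; have := perm_mem perm_oc b.+1.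
  rewrite mem_cat mem_iota add1n /= ltnS ltn_ord.
  move: uniq_oc; rewrite cat_uniq => /and3P[_ /hasPn dis _].
  by case: (boolP (b.+1 \in col2 T)) => [/dis/negPf->|]; rewrite ?orbF.
by apply: sorted_points => // x xc; rewrite rng // mem_cat xc orbT.
Qed.

(** A closer has its partner in the first column, so dropping empty columns never moves the second
    column into first place. *)
Lemma matching_tableau_columns s : involutive s ->
  col1 (matching_tableau s) = points (fun b => ~~ (s b < b)) /\
  col2 (matching_tableau s) = points (fun b => s b < b).
Proof.
move=> sK; rewrite /matching_tableau.
case e1 : (points (fun b => ~~ (s b < b))) => [|x c1];
  case e2 : (points (fun b => s b < b)) => [|y c2] //.
exfalso; have /mapP[b] : y \in points (fun b => s b < b) by rewrite e2 mem_head.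
rewrite mem_filter => /andP[sbb _] _.
have : (s b).+1 \in points (fun b => ~~ (s b < b)).
  by rewrite mem_points sK -leqNgt ltnW.
by rewrite e1.
Qed.

Lemma matching_tableau_closers s : involutive s -> has_closers (matching_tableau s) s.
Proof. by move=> sK b; rewrite (matching_tableau_columns sK).2 mem_points. Qed.

(** Pigeonhole: the partners of the first [r + 1] closers are distinct elements of the first column.
    If the entries of row [r] were not increasing, all these partners would be among the first [r]
    elements of that column. *)
Lemma points_row s r : involutive s ->
  r < size (points (fun b => s b < b)) ->
  r < size (points (fun b => ~~ (s b < b))) /\
  nth 0 (points (fun b => ~~ (s b < b))) r < nth 0 (points (fun b => s b < b)) r.
Proof.
move=> sK; set c2 := points _; set c1 := points _ => rc2.
pose sn x := if insub x.-1 is Some b then (s b).+1 else 0.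
have c2P x : x \in c2 -> sn x \in c1 /\ sn x < x.
  case/mapP=> b; rewrite mem_filter => /andP[sbb _] ->.
  by rewrite /sn /= valK mem_points /= sK -leqNgt ltnS; split=> //; apply: ltnW.
have sn_inj : {in c2 &, injective sn}.
  move=> x y /mapP[b _ ->] /mapP[c _ ->]; rewrite /sn /= !valK => -[].
  by move/val_inj/perm_inj->.
pose l := [seq sn x | x <- take r.+1 c2].
have take_c2 : {subset take r.+1 c2 <= c2} by move=> x /mem_take.
have uniq_c2 : uniq c2 by apply: (sorted_uniq ltn_trans ltnn); apply: points_sorted.
have uniq_l : uniq l.
  rewrite map_inj_in_uniq ?take_uniq // => x y /take_c2 xc /take_c2 yc; exact: sn_inj.
have size_l : size l = r.+1 by rewrite size_map size_takel.
have sub_l : {subset l <= c1} by move=> x /mapP[y /take_c2 /c2P[+ _] ->].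
have rc1 : r < size c1 by rewrite -size_l uniq_leq_size.
split=> //; rewrite ltnNge; apply/negP => le_c.
suff : {subset l <= take r c1}.
  by move/(uniq_leq_size uniq_l); rewrite size_l size_takel ?ltnn // ltnW.
have nth_mono (c : seq nat) i j : sorted ltn c -> i < size c -> j < size c -> i <= j ->
    nth 0 c i <= nth 0 c j.
  move=> srt isz jsz; rewrite leq_eqVlt => /predU1P[->//|ij].
  exact: ltnW (sorted_ltn_nth ltn_trans 0 srt i j isz jsz ij).
move=> x xl; have xc1 := sub_l x xl.
suff lt_i : index x c1 < r.
  by rewrite -[x](nth_index 0 xc1) -(nth_take 0 lt_i) mem_nth // size_takel // ltnW.
rewrite ltnNge; apply/negP => le_i.
have ix : index x c1 < size c1 by rewrite index_mem.
have h1 := nth_mono c1 r (index x c1) (points_sorted _) rc1 ix le_i.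
have [y yt xy] := mapP xl; have yc2 := take_c2 y yt.
have [_ lt_y] := c2P y yc2; rewrite -xy in lt_y.
have iy : index y c2 <= r.
  have := index_ltn yt; by rewrite ltnS.
have iy' : index y c2 < size c2 by rewrite index_mem.
have h2 := nth_mono c2 (index y c2) r (points_sorted _) iy' rc2 iy.
rewrite nth_index // in h1; rewrite nth_index // in h2.
by lia.
Qed.

Lemma matching_tableau_two_column s : involutive s ->
  two_column_tableaux n (matching_tableau s).
Proof.
move=> sK; have [e1 e2] := matching_tableau_columns sK.
split; last first.
  by rewrite size_filter; apply: leq_trans (count_size _ _) _.
have size21 : size (points (fun b => s b < b)) <= size (points (fun b => ~~ (s b < b))).
  case e : (size (points (fun b => s b < b))) => [//|r].
  by have [|] := @points_row s r sK; rewrite ?e.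
split.
- by rewrite mem_filter eqxx.
- rewrite /matching_tableau shape_filter.
  by case: (size (points _)) size21 => [|m]; case: (size _) => //= k; rewrite andbT.
- have -> : flatten (matching_tableau s) =
     points (fun b => ~~ (s b < b)) ++ points (fun b => s b < b).
    rewrite /matching_tableau.
    by case: (points _) => [|? ?]; case: (points _) => [|? ?] //=; rewrite ?cats0.
  rewrite /points -map_cat perm_sym.
  have -> : iota 1 n = [seq (val b).+1 | b <- enum 'I_n].
    by rewrite (map_comp succn val) val_enum_ord -[1]/(1 + 0) iotaDl.
  by rewrite perm_map // perm_sym perm_catC perm_filterC.
- by apply/allP => c; rewrite mem_filter !inE => /andP[_ /orP[] /eqP ->]; apply: points_sorted.
- case=> [|c] r; first by rewrite e1 e2 => /(points_row sK)[].
  rewrite (_ : nth [::] (matching_tableau s) c.+2 = [::]) //.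
  rewrite nth_default // size_filter; apply: leq_trans (count_size _ _) _.
  by rewrite /=.
Qed.

End MatchingTableau.

End TwoColumns.

Local Open Scope classical_set_scope.
Local Open Scope ring_scope.

(** * The Borel group and corner ranks *)

Section Borel.
Variables (F : fieldType) (n : nat).
Implicit Types (A B u v : 'M[F]_n) (i j k : 'I_n) (s : 'S_n).

Lemma upper_borel A : (forall i j, (j < i)%N -> A i j = 0) ->
  (forall i, A i i != 0) -> borel A.
Proof.
move=> upA diagA; split=> //; rewrite unitmxE unitfE -det_tr det_trig.
  by apply/prodf_neq0 => i _; rewrite mxE.
by apply/is_trig_mxP => i j ij; rewrite mxE upA.
Qed.

Lemma borel_diag A i : borel A -> A i i != 0.
Proof.
case=> unitA upA; move: unitA; rewrite unitmxE unitfE -det_tr det_trig.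
  by move/prodf_neq0/(_ i isT); rewrite mxE.
by apply/is_trig_mxP => a b ab; rewrite mxE upA.
Qed.

Lemma borel_mul A B : borel A -> borel B -> borel (A *m B).
Proof.
move=> [uA upA] [uB upB]; split; first by rewrite unitmx_mul uA.
move=> i j ji; rewrite mxE big1 // => k _.
have [ki|ik] := ltnP k i; first by rewrite upA ?mul0r.
by rewrite (upB k j) ?mulr0 //; lia.
Qed.

Lemma borel_inv A : borel A -> borel (invmx A).
Proof.
move=> bA; have [uA upA] := bA; split; first by rewrite unitmx_inv.
move=> i j; have [m] := ubnP j; elim: m j => // m IHm j jm ji.
have : (invmx A *m A) i j = 0.
  by rewrite mulVmx // mxE (_ : (i == j) = false) // -val_eqE /=; lia.
rewrite mxE (bigD1 j) //= big1 => [|k kj]; last first.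
  have [jk|kj'] := ltnP j k; first by rewrite upA ?mulr0.
  by rewrite IHm ?mul0r //; move: kj; rewrite -val_eqE /=; lia.
by rewrite addr0 => /eqP; rewrite mulf_eq0 (negPf (borel_diag _ bA)) orbF => /eqP.
Qed.

Lemma strictly_upper_conj A u : borel A -> strictly_upper u ->
  strictly_upper (A *m u *m invmx A).
Proof.
move=> bA su; have [_ upA] := bA; have [_ upV] := borel_inv bA.
move=> i j ji; rewrite mxE big1 // => k _.
have [jk|kj] := ltnP j k; first by rewrite upV ?mulr0.
rewrite mxE big1 ?mul0r // => l _.
have [li|il] := ltnP l i; first by rewrite upA ?mul0r.
by rewrite su ?mulr0 //; lia.
Qed.

Lemma conj_mul A u v : A \in unitmx ->
  (A *m u *m invmx A) *m (A *m v *m invmx A) = A *m (u *m v) *m invmx A.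
Proof. by move=> uA; rewrite !mulmxA mulmxKV. Qed.

Lemma borel_orbitP u v : borel_orbit u v <->
  exists2 A, borel A & v *m A = A *m u.
Proof.
split=> -[A bA]; have [uA _] := bA.
  by move=> <-; exists A => //; rewrite mulmxKV.
by move=> e; exists A => //; rewrite -e mulmxK.
Qed.

Lemma borel_orbit_trans A u v : borel A -> borel_orbit u v ->
  borel_orbit u (A *m v *m invmx A).
Proof.
move=> bA /borel_orbitP[B bB e]; apply/borel_orbitP.
exists (A *m B); first exact: borel_mul.
by have [uA _] := bA; rewrite mulmxA mulmxKV // -!mulmxA e.
Qed.

Lemma borel_orbit_square u v : u *m u = 0 -> borel_orbit u v -> v *m v = 0.
Proof. by move=> uu [A [uA _] <-]; rewrite conj_mul // uu mulmx0 mul0mx. Qed.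

Lemma borel_orbit_strictly_upper u v : strictly_upper u -> borel_orbit u v ->
  strictly_upper v.
Proof. by move=> su [A bA <-]; apply: strictly_upper_conj. Qed.

End Borel.

Section Blocks.
Variables (R : pzRingType) (n : nat).

(** The corner is padded with zeros to full size, which makes it a product of [u] with two
    projections ([cornerE]) for all bounds at once. *)
Definition corner (u : 'M[R]_n) (i j : nat) : 'M[R]_n :=
  \matrix_(a, c) (if (i <= a)%N && (c < j)%N then u a c else 0).

Definition row_proj (i : nat) : 'M[R]_n :=
  \matrix_(a, c) ((a == c) && (i <= a)%N)%:R.
Definition col_proj (j : nat) : 'M[R]_n :=
  \matrix_(a, c) ((a == c) && (c < j)%N)%:R.

Lemma row_projE i (u : 'M[R]_n) : 
  row_proj i *m u = \matrix_(a, c) (if (i <= a)%N then u a c else 0).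
Proof.
apply/matrixP => a c; rewrite !mxE (bigD1 a) //= big1 => [|k ka].
  by rewrite mxE eqxx addr0 /=; case: ifP; rewrite ?mul1r ?mul0r.
by rewrite mxE eq_sym (negPf ka) mul0r.
Qed.

Lemma col_projE j (u : 'M[R]_n) : 
  u *m col_proj j = \matrix_(a, c) (if (c < j)%N then u a c else 0).
Proof.
apply/matrixP => a c; rewrite !mxE (bigD1 c) //= big1 => [|k ka].
  by rewrite mxE eqxx addr0 /=; case: ifP; rewrite ?mulr1 ?mulr0.
by rewrite mxE (negPf ka) mulr0.
Qed.

Lemma cornerE u i j : corner u i j = row_proj i *m u *m col_proj j.
Proof.
rewrite row_projE col_projE; apply/matrixP => a c; rewrite !mxE.
by case: (i <= a)%N; case: (c < j)%N.
Qed.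

End Blocks.

Section BlockRanks.
Variables (F : fieldType) (n : nat).
Implicit Types (A B u v : 'M[F]_n) (s : 'S_n).

(** Upper triangular factors add lower rows to higher ones and earlier columns to later ones. Hence
    the corner of the conjugate is a product having the corner of [u] as a factor. *)
Lemma corner_rank_le A u i j : borel A ->
  (\rank (corner (A *m u *m invmx A) i j) <= \rank (corner u i j))%N.
Proof.
move=> bA; have [_ upA] := bA; have [_ upV] := borel_inv bA.
have eL : row_proj F n i *m A = row_proj F n i *m A *m row_proj F n i.
  apply/matrixP => a c; rewrite row_projE !mxE (bigD1 c) //= big1 => [|k kc].
    rewrite !mxE eqxx addr0 /=; case: ifP => // ia; last by rewrite mul0r.
    case: (leqP i c) => ic; rewrite ?mulr1 // upA ?mul0r //; lia.
  by rewrite !mxE (negPf kc) mulr0.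
have eC : invmx A *m col_proj F n j =
    col_proj F n j *m (invmx A *m col_proj F n j).
  apply/matrixP => a c; rewrite col_projE !mxE (bigD1 a) //= big1 => [|k kc].
    rewrite !mxE eqxx addr0 /=; case: ifP => // ia; last by rewrite mulr0.
    case: (ltnP a j) => ic; rewrite ?mul1r ?mul0r // upV //; lia.
  by rewrite !mxE eq_sym (negPf kc) mul0r.
rewrite !cornerE -!mulmxA eC !mulmxA eL -!mulmxA.
apply: leq_trans (mxrankM_maxr _ _) _.
apply: leq_trans (mxrankM_maxr _ _) _.
by rewrite !mulmxA; apply: leq_trans (mxrankM_maxl _ _) _; apply: mxrankM_maxl.
Qed.

Lemma corner_rank_orbit u v i j : borel_orbit u v ->
  \rank (corner v i j) = \rank (corner u i j).
Proof.
move=> [A bA <-]; apply/eqP; rewrite eqn_leq corner_rank_le //=.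
have [uA _] := bA.
have {1}-> : u = invmx A *m (A *m u *m invmx A) *m invmx (invmx A).
  by rewrite invmxK !mulmxA mulVmx // mul1mx mulmxKV.
exact/corner_rank_le/borel_inv.
Qed.

Lemma corner_full u : corner u 0 n = u.
Proof. by apply/matrixP => a c; rewrite mxE ltn_ord. Qed.

(** The upper bound is subadditivity of the rank. Applied to the complement of [p] it yields the
    lower bound, because the two diagonal matrices add up to the identity. *)
Lemma rank_diag_bool (p : pred 'I_n) :
  \rank (diag_mx (\row_i (p i)%:R) : 'M[F]_n) = (\sum_i p i)%N.
Proof.
have le (q : pred 'I_n) : (\rank (diag_mx (\row_i (q i)%:R) : 'M[F]_n) <= \sum_i q i)%N.
  have -> : diag_mx (\row_i (q i)%:R) = \sum_i (q i)%:R *: (delta_mx i i : 'M[F]_n).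
    apply/matrixP => a c; rewrite !mxE summxE (bigD1 a) //= big1 => [|k ka].
      by rewrite !mxE eqxx addr0 eq_sym /=; case: eqP; rewrite ?mulr1 ?mulr0.
    by rewrite !mxE eq_sym (negPf ka) mulr0.
  elim/big_rec2: _ => [|i m B _ le_B]; first by rewrite mxrank0.
  apply: leq_trans (mxrank_add _ _) _; apply: leq_add => //.
  by case: (q i); rewrite ?scale1r ?scale0r ?mxrank_delta ?mxrank0.
apply/eqP; rewrite eqn_leq le /=; have leC := le (predC p).
have le_n : (n <= \rank (diag_mx (\row_i (p i)%:R) : 'M[F]_n) +
             \rank (diag_mx (\row_i (predC p i)%:R) : 'M[F]_n))%N.
  apply: leq_trans (mxrank_add _ _); rewrite -[X in (X <= _)%N](mxrank1 F n).
  rewrite (_ : _ + _ = 1%:M) //; apply/matrixP => a c; rewrite !mxE -mulrnDl.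
  by rewrite -natrD /=; case: (p a).
have sum_n : (\sum_i p i + \sum_i predC p i = n)%N.
  rewrite -big_split /= -[RHS]card_ord -sum1_card; apply: eq_bigr => i _.
  by case: (p i).
rewrite -(leq_add2r (\sum_i predC p i)) sum_n; apply: leq_trans le_n _.
by rewrite leq_add2l.
Qed.

Definition matching_mx s : 'M[F]_n := \matrix_(i, j) ((i < j)%N && (s i == j))%:R.

(** The corner is a 0/1 diagonal matrix times the permutation matrix of [s]. *)
Lemma matching_corner_rank s i j :
  \rank (corner (matching_mx s) i j) = arcs_in s i j.
Proof.
rewrite /arcs_in -(rank_diag_bool (fun a => [&& i <= a, a < s a & s a < j]%N)).
rewrite -[RHS](mxrankMfree _ (B := perm_mx s)); last first.
  by rewrite row_free_unit unitmx_perm.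
congr (\rank _); apply/matrixP => a c.
rewrite mul_diag_mx !mxE.
have [<-|ne] /= := eqVneq (s a) c; last by rewrite !andbF mulr0 if_same.
by rewrite andbT mulr1 andbA andbAC; case: (_ && _) => //=; case: (a < s a)%N.
Qed.

Lemma matching_mxE s i j : involutive s ->
  matching_mx s i j = ((s j < j)%N && (i == s j))%:R.
Proof.
move=> sK; rewrite mxE; have [<-|ne] := eqVneq (s i) j; first by rewrite sK eqxx.
rewrite andbF; case: eqP => [e|]; last by rewrite andbF.
by case/eqP: ne; rewrite e sK.
Qed.

Lemma matching_strictly_upper s : strictly_upper (matching_mx s).
Proof. by move=> i j ji; rewrite mxE ltnNge ji. Qed.

Lemma mul_matching s u i j : involutive s ->
  (matching_mx s *m u) i j = if (i < s i)%N then u (s i) j else 0.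
Proof.
move=> sK; rewrite mxE (bigD1 (s i)) //= big1 => [|k ki].
  by rewrite mxE eqxx andbT addr0; case: ifP; rewrite ?mul1r ?mul0r.
by rewrite mxE eq_sym (negPf ki) andbF mul0r.
Qed.

Lemma mul_mx_matching s u i j : involutive s ->
  (u *m matching_mx s) i j = if (s j < j)%N then u i (s j) else 0.
Proof.
move=> sK; rewrite mxE (bigD1 (s j)) //= big1 => [|k ki].
  by rewrite mxE sK eqxx andbT addr0; case: ifP; rewrite ?mulr1 ?mulr0.
rewrite mxE (_ : (s k == j) = false) ?andbF ?mulr0 //.
by apply: contraNF ki => /eqP <-; rewrite sK.
Qed.

Lemma matching_square s : involutive s -> matching_mx s *m matching_mx s = 0.
Proof.
move=> sK; apply/matrixP => i j; rewrite mul_matching // !mxE sK.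
by case: ifP => // lt_i; case: eqP => [<-|]; rewrite ?andbF // ltnNge ltnW.
Qed.

End BlockRanks.

(** * Classification of the Borel orbits *)

Section Classification.
Variables (F : fieldType) (n : nat).
Implicit Types (A B u v : 'M[F]_n) (i j k : 'I_n) (s : 'S_n).

Section Step.
Variables (v : 'M[F]_n) (s : 'S_n) (b : 'I_n).
Hypotheses (sv : strictly_upper v) (vv : v *m v = 0) (sK : involutive s).
Hypothesis fix_ge : forall x : 'I_n, (b <= x)%N -> s x = x.
Hypothesis v_lt : forall i j, (j < b)%N -> v i j = matching_mx F s i j.

Let moved_lt i : s i != i -> (i < b)%N.
Proof. by apply: contraNltn => /fix_ge ->. Qed.

(** Row [s i] of [v] has, before column [b], a single 1 at [i], so the entry of [v *m v] at
    [(s i, b)] is [v i b]. *)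
Let closer_zero i : (s i < i)%N -> v i b = 0.
Proof.
move=> si; have lt_ib : (i < b)%N by rewrite moved_lt // -val_eqE /= ltn_eqF.
have : (v *m v) (s i) b = 0 by rewrite vv mxE.
rewrite mxE (bigD1 i) //= big1 => [|k ki].
  by rewrite v_lt // mxE si sK eqxx mul1r addr0.
have [kb|bk] := ltnP k b; last by rewrite [v k b]sv // mulr0.
by rewrite v_lt // mxE sK eq_sym (negPf ki) andbF mul0r.
Qed.

(* What remains of column b of v once the part matched by s is cleared. *)
Let w i : F := if s i == i then v i b else 0.
(** This is the new [b]-th basis vector. Column [k] of [v] at a closer [k] is the unit vector at
    [s k], so the subtracted terms clear column [b] at the openers; at the closers it vanishes
    already. *)
Let corr i : F := (i == b)%:R - (if (s i < i)%N then v (s i) b else 0).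

Let col_corr i : \sum_k v i k * corr k = w i.
Proof.
rewrite (eq_bigr (fun k => v i k * (k == b)%:R -
    v i k * (if (s k < k)%N then v (s k) b else 0))); last by move=> k _; rewrite mulrBr.
rewrite sumrB (bigD1 b) //= big1 => [|k kb]; last by rewrite (negPf kb) mulr0.
rewrite eqxx mulr1 addr0 (bigD1 (s i)) //= big1 => [|k ki]; last first.
  case: ifP => lt_k; last by rewrite mulr0.
  rewrite v_lt ?moved_lt //; last by rewrite -val_eqE /= ltn_eqF.
  by rewrite mxE eq_sym (negPf ki) andbF mul0r.
rewrite sK addr0 /w; case: (ltngtP i (s i)) => [lt_i|lt_i|/val_inj e].
- have nfix : (s i == i) = false by rewrite -val_eqE /= gtn_eqF.
  have si_b : (s i < b)%N by rewrite moved_lt // (inj_eq perm_inj) nfix.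
  by rewrite (v_lt i si_b) mxE lt_i eqxx mul1r subrr nfix.
- by rewrite mulr0 subr0 closer_zero // if_same.
- by rewrite mulr0 subr0 -e eqxx.
Qed.

Let w_ge i : (b <= i)%N -> w i = 0.
Proof. by move=> bi; rewrite /w sv // if_same. Qed.

(** If the remainder [w] is zero, [b] stays unmatched. Otherwise [b] is matched with the last index
    [f] in the support of [w], and [w] becomes the new [f]-th basis vector; [v] kills it, as its
    support is unmatched. *)
Lemma classification_step : exists B s', [/\ borel B, involutive s',
  forall x : 'I_n, (b < x)%N -> s' x = x
  & forall i j, (j <= b)%N -> (v *m B) i j = (B *m matching_mx F s') i j].
Proof.
have sb : s b = b by rewrite fix_ge.
have corr_low i : (b < i)%N -> corr i = 0.
  by move=> bi; rewrite /corr fix_ge ?(ltnW bi) // ltnn subr0 -val_eqE /= gtn_eqF.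
have corr_b : corr b = 1 by rewrite /corr eqxx sb ltnn subr0.
have [/existsP[f0 wf0]|/existsPn w0] := boolP [exists f, w f != 0]; last first.
  have {}w0 i : w i = 0 by apply/eqP; rewrite -[_ == _]negbK w0.
  pose B := \matrix_(i, j) (if j == b then corr i else (i == j)%:R) : 'M[F]_n.
  exists B, s; split=> //.
  - apply: upper_borel => [i j ji|i]; rewrite mxE.
      case: eqP => [jb|_]; first by rewrite corr_low -?jb.
      by rewrite -val_eqE /= gtn_eqF.
    by have [->|_] := eqVneq i b; rewrite ?corr_b ?eqxx oner_eq0.
  - by move=> x /ltnW; apply: fix_ge.
  move=> i j jb; rewrite mul_mx_matching // [LHS]mxE.
  have [->|nb] := eqVneq j b.
    rewrite sb ltnn -[RHS](w0 i) -col_corr; apply: eq_bigr => k _.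
    by rewrite mxE eqxx.
  have {}jb : (j < b)%N by move: nb jb; rewrite -val_eqE /=; lia.
  rewrite (bigD1 j) //= big1 => [|k kj]; last by rewrite mxE (negPf nb) (negPf kj) mulr0.
  rewrite mxE (negPf nb) eqxx mulr1 addr0 v_lt // matching_mxE //.
  case: ltnP => //= sj; rewrite mxE (_ : (s j == b) = false) //.
  by rewrite -val_eqE /= ltn_eqF //; apply: ltn_trans jb.
(* Taking [f] largest makes column [f] of [B], filled with [w], upper triangular with a nonzero
   diagonal entry. *)
case: (@arg_maxnP _ f0 (fun f => w f != 0) (fun f => val f) wf0) => f wf maxf.
have fixf : s f = f.
  by apply/eqP; apply: contraNT wf => /negPf nf; rewrite /w nf.
have fb : (f < b)%N by rewrite ltnNge; apply: contra wf => /w_ge ->.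
have w_gt i : (f < i)%N -> w i = 0.
  move=> fi; apply/eqP; apply: contraTT fi => wi; rewrite -leqNgt; exact: maxf.
have fnb : (f == b) = false by rewrite -val_eqE /= ltn_eqF.
pose B := \matrix_(i, j) (if j == b then corr i else
  if j == f then w i else (i == j)%:R) : 'M[F]_n.
pose s' : 'S_n := (s * tperm f b)%g.
have s'f : s' f = b by rewrite permM fixf tpermL.
have s'b : s' b = f by rewrite permM sb tpermR.
have s'E i : i != f -> i != b -> s' i = s i.
  move=> nf nb; rewrite permM tpermD //.
    by apply: contraNneq nf => e; rewrite -(sK i) -e fixf.
  by apply: contraNneq nb => e; rewrite -(sK i) -e sb.
have s'K : involutive s'.
  move=> i; have [->|nf] := eqVneq i f; first by rewrite s'f s'b.
  have [->|nb] := eqVneq i b; first by rewrite s'b s'f.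
  rewrite (s'E i) // s'E ?sK //.
    by apply: contraNneq nf => e; rewrite -(sK i) e fixf.
  by apply: contraNneq nb => e; rewrite -(sK i) e sb.
exists B, s'; split=> //.
- apply: upper_borel => [i j ji|i]; rewrite mxE.
    case: eqP => [jb|_]; first by rewrite corr_low -?jb.
    case: eqP => [jf|_]; first by rewrite w_gt -?jf.
    by rewrite -val_eqE /= gtn_eqF.
  have [->|_] := eqVneq i b; first by rewrite corr_b oner_eq0.
  by have [->|_] := eqVneq i f; rewrite ?eqxx ?oner_eq0.
- move=> x bx; rewrite s'E ?fix_ge ?(ltnW bx) // -val_eqE /= gtn_eqF //.
  exact: ltn_trans bx.
move=> i j jb; rewrite mul_mx_matching // [LHS]mxE.
have [->|nb] := eqVneq j b.
  rewrite s'b fb mxE fnb eqxx -col_corr; apply: eq_bigr => k _.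
  by rewrite mxE eqxx.
have {}jb : (j < b)%N by move: nb jb; rewrite -val_eqE /=; lia.
have [->|nf] := eqVneq j f.
  rewrite s'f ltnNge (ltnW fb) /= big1 // => k _; rewrite mxE fnb eqxx.
  have [kb|bk] := ltnP k b; last by rewrite w_ge ?mulr0.
  rewrite v_lt // mxE; have [<-|] := eqVneq (s i) k; last by rewrite andbF mul0r.
  rewrite /w sK; case: eqP => [<-|]; last by rewrite mulr0.
  by rewrite ltnn mul0r.
rewrite (bigD1 j) //= big1 => [|k kj]; last first.
  by rewrite mxE (negPf nb) (negPf nf) (negPf kj) mulr0.
rewrite mxE (negPf nb) (negPf nf) eqxx mulr1 addr0 v_lt // s'E // matching_mxE //.
case: ltnP => //= sj; rewrite mxE (_ : (s j == b) = false); last first.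
  by rewrite -val_eqE /= ltn_eqF //; apply: ltn_trans jb.
rewrite (_ : (s j == f) = false) //.
by apply: contraNF nf => /eqP e; rewrite -(sK j) e fixf.
Qed.

End Step.

(** After [m] steps the first [m] columns of the current conjugate are those of a matching matrix
    and the points from [m] on are unmatched; [classification_step] then treats column [m]. *)
Lemma matching_normal_form u : strictly_upper u -> u *m u = 0 ->
  exists2 s : 'S_n, involutive s & borel_orbit (matching_mx F s) u.
Proof.
move=> su uu.
suff [A [s [bA sK _ eA]]] : exists A s, [/\ borel A, involutive s,
    forall x : 'I_n, (n <= x)%N -> s x = x
    & forall i j, (j < n)%N -> (u *m A) i j = (A *m matching_mx F s) i j].
  exists s => //; apply/borel_orbitP; exists A => //.
  by apply/matrixP => i j; apply: eA.
have prefix m : (m <= n)%N -> exists A s, [/\ borel A, involutive s,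
    forall x : 'I_n, (m <= x)%N -> s x = x
    & forall i j, (j < m)%N -> (u *m A) i j = (A *m matching_mx F s) i j].
  elim: m => [_|m IHm lt_mn].
    exists 1%:M, 1%g; split=> // [|x|x _]; rewrite ?perm1 //.
    apply: upper_borel => [i j ji|i]; rewrite mxE ?eqxx ?oner_eq0 //.
    by rewrite -val_eqE /= gtn_eqF.
  have [A [s [bA sK fix_ge eA]]] := IHm (ltnW lt_mn).
  have [uA _] := bA; have bV := borel_inv bA.
  pose v := invmx A *m u *m invmx (invmx A).
  have vE : u *m A = A *m v by rewrite /v invmxK !mulmxA mulmxV // mul1mx.
  have [|||B [s' [bB s'K fix_gt eB]]] :=
    @classification_step v s (Ordinal lt_mn) _ _ sK fix_ge.
  - exact: strictly_upper_conj.
  - by rewrite conj_mul ?unitmx_inv // uu mulmx0 mul0mx.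
  - move=> i j jm; have -> : v = invmx A *m (u *m A) by rewrite /v invmxK mulmxA.
    rewrite mxE -[matching_mx F s](mulKmx uA) [in RHS]mxE.
    by apply: eq_bigr => k _; rewrite eA.
  exists (A *m B), s'; split=> //; first exact: borel_mul.
  move=> i j jm; rewrite mulmxA vE -[A *m v *m B]mulmxA -[A *m B *m _]mulmxA mxE [RHS]mxE.
  by apply: eq_bigr => k _; rewrite eB.
exact: prefix.
Qed.

End Classification.

(** * Zariski closures and degenerations *)

Section Closure.
Variables (F : fieldType) (n : nat).
Implicit Types (A B : set 'M[F]_n).

Lemma zariski_closure_sub A B : A `<=` zariski_closure B ->
  zariski_closure A `<=` zariski_closure B.
Proof.
move=> AB u Au M [cM BM]; apply: Au; split=> // v /AB; exact.
Qed.

Lemma sub_zariski_closure A : A `<=` zariski_closure A.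
Proof. exact: sub_gen_smallest. Qed.

Lemma zariski_closure_min A B : zariski_closed B -> A `<=` B ->
  zariski_closure A `<=` B.
Proof. exact: smallest_sub. Qed.

Definition generic_mx : 'M[{mpoly F[n * n]}]_n :=
  \matrix_(i, j) 'X_(mxvec_index i j).

Lemma generic_mx_eval (u : 'M[F]_n) :
  map_mx (meval (fun k => mxvec u ord0 k)) generic_mx = u.
Proof. by apply/matrixP => i j; rewrite !mxE mevalXU mxvecE. Qed.

(** A nonzero minor of size [k] forces rank at least [k]; conversely a maximal free set of rows, and
    then of columns, gives a nonzero minor of size [\rank M]. *)
Lemma rank_minorsP m p (M : 'M[F]_(m, p)) (r : nat) :
  (\rank M <= r)%N <-> forall k (f : 'I_k -> 'I_m) (g : 'I_k -> 'I_p),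
    (r < k)%N -> \det (mxsub f g M) = 0.
Proof.
split=> [le_r k f g lt_rk|minors0].
  apply/eqP; apply: contraTT lt_rk => det_neq0; rewrite -leqNgt.
  have : mxsub f g M \in unitmx by rewrite unitmxE unitfE.
  rewrite -row_free_unit => /eqP {1}<-; apply: leq_trans le_r.
  have -> : mxsub f g M = rowsub f M *m colsub g 1%:M by rewrite -mxsub_mul mulmx1.
  by apply: leq_trans (mxrankM_maxl _ _) _; apply/mxrankS/rowsub_sub.
rewrite leqNgt; apply/negP => lt_r.
pose N := rowsub (maxrankfun M) M.
have fullN : row_full N^T by rewrite /row_full mxrank_tr; apply: maxrowsub_free.
have := minors0 _ (maxrankfun M) (fullrankfun fullN) lt_r.
have -> : mxsub (maxrankfun M) (fullrankfun fullN) M = (rowsub (fullrankfun fullN) N^T)^T.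
  by apply/matrixP => i j; rewrite !mxE.
move/eqP; rewrite det_tr; apply/negP; rewrite -unitfE -unitmxE -row_free_unit.
by rewrite /row_free mxrank_fullrowsub.
Qed.

Lemma zariski_closed_corners (r : nat -> nat -> nat) :
  zariski_closed [set u : 'M[F]_n | [/\ strictly_upper u, u *m u = 0
    & forall i j, (\rank (corner u i j) <= r i j)%N]].
Proof.
pose ev (u : 'M[F]_n) := meval (fun k => mxvec u ord0 k).
exists [set p | (exists i j, p = (generic_mx *m generic_mx) i j) \/
  (exists i j k (f g : 'I_k -> 'I_n),
     (r i j < k)%N /\ p = \det (mxsub f g (corner generic_mx i j)))].
have square_ev u i j : ev u ((generic_mx *m generic_mx) i j) = (u *m u) i j.
  by rewrite -[in RHS](generic_mx_eval u) -map_mxM [RHS]mxE.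
have minor_ev u i j k (f g : 'I_k -> 'I_n) :
    ev u (\det (mxsub f g (corner generic_mx i j))) = \det (mxsub f g (corner u i j)).
  rewrite /ev -det_map_mx; congr (\det _); apply/matrixP => a c.
  rewrite -[in RHS](generic_mx_eval u) !mxE; case: ifP => _; rewrite ?mxE //.
  exact: rmorph0.
apply/seteqP; split=> u [su].
  move=> uu ranks; split=> // p [[i [j ->]]|[i [j [k [f [g [lt_rk ->]]]]]]].
    by rewrite -[_.@[_]]/(ev u _) square_ev uu mxE.
  by rewrite -[_.@[_]]/(ev u _) minor_ev; exact: (rank_minorsP _ _).1 (ranks i j) _ f g lt_rk.
move=> zeros; split=> //.
  apply/matrixP => i j; rewrite -square_ev [RHS]mxE; apply: zeros; left; by exists i, j.
move=> i j; apply/rank_minorsP => k f g lt_rk; rewrite -minor_ev; apply: zeros.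
by right; exists i, j, k, f, g.
Qed.

End Closure.

(** * Degenerations along lines *)

Section Degeneration.
Variables (F : numFieldType) (n : nat).
Implicit Types (A B : set 'M[F]_n) (s t : 'S_n).

(** A polynomial vanishing on [A] restricts to a one-variable polynomial [q] on the line. It has the
    roots 1, ..., [size q], distinct in a number field, so it is zero, also at the parameter 0. *)
Lemma zariski_closure_line A (M0 M1 : 'M[F]_n) : strictly_upper M0 ->
  (forall e : F, e != 0 -> A (M0 + e *: M1)) -> zariski_closure A M0.
Proof.
move=> su0 line M [[I ->] AM]; split=> // p Ip.
pose h (k : 'I_(n * n)) : {poly F} := (mxvec M0 ord0 k)%:P + 'X * (mxvec M1 ord0 k)%:P.
pose q : {poly F} := \sum_(m <- msupp p) (p@_m)%:P * \prod_i h i ^+ m i.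
have qE e : q.[e] = p.@[fun k => mxvec (M0 + e *: M1) ord0 k].
  rewrite /q horner_sum mevalE; apply: eq_bigr => m _.
  rewrite hornerM hornerC horner_prod; congr (_ * _); apply: eq_bigr => k _.
  rewrite horner_exp /h !hornerE; congr (_ ^+ _).
  by rewrite linearD linearZ !mxE.
have q0 : q = 0.
  apply/eqP; apply: contraT => q_neq0.
  have := @max_poly_roots _ q [seq (k%:R : F) | k <- iota 1 (size q)] q_neq0.
  rewrite size_map size_iota ltnn; apply=> //.
    apply/allP => x /mapP[k]; rewrite mem_iota => /andP[k0 _] ->.
    rewrite /root qE; apply/eqP.
    have k_neq0 : (k%:R : F) != 0 by rewrite pnatr_eq0 -lt0n.
    by have [_ /(_ _ Ip)] := AM _ (line _ k_neq0).
  rewrite map_inj_uniq ?iota_uniq //; move=> i j /eqP; rewrite eqr_nat => /eqP.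
  exact.
by have := qE 0; rewrite q0 horner0 scale0r addr0 => <-.
Qed.

Let N s := matching_mx F s.

(* e_ji(eps) lies in the Bruhat cell of the transposition (i j): it equals
   b * perm_mx (tperm i j) * x with x = e_ij(1/eps).  When x, corrected by Z,
   commutes with N s, conjugating N s by e_ji(eps) stays in the Borel orbit of
   the transposed matching, and tends to N s as eps goes to 0. *)
Lemma tperm_degeneration s (i j : 'I_n) (Z : 'M[F]_n) : involutive s -> (i < j)%N ->
  (forall x, (tperm i j x < tperm i j (s x))%N = (x < s x)%N) ->
  s i != j ->
  (forall x y : 'I_n, (y <= x)%N -> Z x (tperm i j y) = 0) ->
  (forall y, Z i y = 0) ->
  (delta_mx i j + Z) *m N s = N s *m (delta_mx i j + Z) ->
  borel_orbit (N s) `<=` zariski_closure (borel_orbit (N (s ^ tperm i j)%g)).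
Proof.
move=> sK ij ordt sij Zup Zi comm.
set t := tperm i j; set D := delta_mx i j + Z.
have ij_neq : (i == j) = false by rewrite -val_eqE /= ltn_eqF.
have ji_neq : (j == i) = false by rewrite eq_sym.
pose E : 'M[F]_n := delta_mx j i.
have EE : E *m E = 0 by rewrite /E mul_delta_mx_cond ij_neq mulr0n.
have ENE : E *m N s *m E = 0.
  apply/matrixP => x y; rewrite mxE big1 ?mxE // => k _.
  have [->|kj] := eqVneq k j; last by rewrite [E k y]mxE (negPf kj) mulr0.
  rewrite [_ x j]mxE (bigD1 i) //= big1 => [|l li].
    by rewrite [N s i j]mxE (negPf sij) andbF mulr0 add0r mul0r.
  by rewrite mxE (negPf li) andbF mul0r.
move=> v [A bA <-]; have [uA _] := bA.
apply: (@zariski_closure_line _ _ (A *m (E *m N s - N s *m E) *m invmx A)).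
  by apply: strictly_upper_conj => //; apply: matching_strictly_upper.
move=> e e0.
(* As [E *m E] and [E *m N s *m E] vanish, [v'] is the conjugate of [N s] by [y]. Since [X] commutes
   with [N s] and [P] transports [N (s ^ t)] to it, the upper triangular product [y *m X *m P] takes
   [N (s ^ t)] to [v']. *)
pose y := 1%:M + e *: E; pose X := 1%:M - e^-1 *: D; pose P : 'M[F]_n := perm_mx t.
pose v' := N s + e *: (E *m N s - N s *m E).
have -> : A *m N s *m invmx A + e *: (A *m (E *m N s - N s *m E) *m invmx A) =
    A *m v' *m invmx A.
  by rewrite [in RHS]mulmxDr [in RHS]mulmxDl -scalemxAr -scalemxAl.
have mulP (B : 'M[F]_n) a c : (B *m P) a c = B a (t c).
  rewrite mxE (bigD1 (t c)) //= big1 => [|k kc].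
    by rewrite !mxE tpermK eqxx mulr1 addr0.
  rewrite !mxE; case: eqP => [tk|]; last by rewrite mulr0.
  by rewrite -tk tpermK eqxx in kc.
apply: borel_orbit_trans => //; apply/borel_orbitP; exists (y *m X *m P).
  have false0 : (false%:R : F) = 0 by [].
  have true1 : (true%:R : F) = 1 by [].
  pose simp := (false0, true1, oppr0, mul0r, mulr0, mul1r, mulr1, addr0, add0r, subr0).
  have yXE x z : (y *m X *m P) x z = (x == t z)%:R
      - e^-1 * ((x == i)%:R * (t z == j)%:R + Z x (t z))
      + e * (x == j)%:R * ((i == t z)%:R - e^-1 * (t z == j)%:R).
    rewrite mulmxDl mul1mx -scalemxAl mulmxDl mxE.
    rewrite !mulP !mxE (bigD1 i) //= big1 => [|k ki]; last first.
      by rewrite !mxE (negPf ki) andbF mul0r.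
    rewrite !mxE !eqxx Zi !andbT addr0 addr0; case: (x == i) => /=;
      rewrite ?mul1r ?mul0r ?mulr0; ring.
  have tE z : z != i -> z != j -> t z = z by move=> zi zj; rewrite tpermD // eq_sym.
  apply: upper_borel => [x z zx|x]; rewrite yXE.
    rewrite Zup 1?ltnW //.
    have [zi|zi] := eqVneq z i.
      rewrite zi tpermL eqxx ij_neq (_ : (x == i) = false); last first.
        by rewrite -val_eqE /= gtn_eqF // -zi.
      by case: (x == j); rewrite ?mulr0n ?mulr1n; field.
    have [zj|zj] := eqVneq z j.
      rewrite zj tpermR eqxx ij_neq.
      rewrite (_ : (x == i) = false); last first.
        by rewrite -val_eqE /= gtn_eqF //; apply: ltn_trans ij _; rewrite -zj.
      rewrite (_ : (x == j) = false); last by rewrite -val_eqE /= gtn_eqF // -zj.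
      by rewrite !simp.
    rewrite tE // (negPf zj) [i == z]eq_sym (negPf zi).
    by rewrite (_ : (x == z) = false) ?simp // -val_eqE /= gtn_eqF.
  rewrite Zup //; have [->|xi] := eqVneq x i.
    by rewrite tpermL ij_neq !eqxx !simp oppr_eq0 invr_eq0.
  have [->|xj] := eqVneq x j.
    by rewrite tpermR ji_neq ij_neq !eqxx !simp.
  by rewrite tE // eqxx (negPf xj) !simp oner_neq0.
(* By [ordt] the transposition reverses no arc, so permuting the entries of the strictly upper
   matrix [N s] gives the matching matrix of the conjugate. *)
have PN : P *m N (s ^ t)%g = N s *m P.
  apply/matrixP => x z; rewrite -row_permE mulP !mxE permJ.
  have -> : (s x == t z) = (t (s x) == z) by rewrite (can2_eq (tpermK i j) (tpermK i j)).
  by case: eqP => [<-|]; rewrite ?andbF // tpermK ordt.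
have XN : X *m N s = N s *m X.
  by rewrite mulmxBl mulmxBr mul1mx mulmx1 -scalemxAl -scalemxAr comm.
have v'y : v' *m y = y *m N s.
  have h : (E *m N s - N s *m E) *m E = 0.
    by rewrite mulmxBl ENE -mulmxA EE mulmx0 subrr.
  rewrite /y [RHS]mulmxDl mul1mx -[in RHS]scalemxAl mulmxDr mulmx1 -scalemxAr.
  by rewrite /v' [(_ + _) *m E]mulmxDl -scalemxAl h scaler0 addr0 scalerBr -addrA subrK.
by rewrite !mulmxA v'y -[y *m N s *m X]mulmxA -XN !mulmxA -[_ *m N s *m P]mulmxA -PN !mulmxA.
Qed.

End Degeneration.

(** * Chains of degenerations between matchings *)

Section Chains.
Variables (F : numFieldType) (n : nat).
Implicit Types (s t : 'S_n) (a b : 'I_n).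

Let N s := matching_mx F s.

Definition degenerates s t : Prop :=
  borel_orbit (N s) `<=` zariski_closure (borel_orbit (N t)).

Lemma degenerates_refl s : degenerates s s.
Proof. exact: sub_zariski_closure. Qed.

Lemma degenerates_trans t s u : degenerates s t -> degenerates t u ->
  degenerates s u.
Proof. by move=> st tu v /st; apply: zariski_closure_sub. Qed.

Let delta_mul (M : 'M[F]_n) (i j x y : 'I_n) :
  ((delta_mx i j : 'M[F]_n) *m M) x y = (x == i)%:R * M j y.
Proof.
rewrite mxE (bigD1 j) //= big1 => [|k kj]; first by rewrite !mxE eqxx andbT addr0.
by rewrite !mxE (negPf kj) andbF mul0r.
Qed.

Let mul_delta (M : 'M[F]_n) (i j x y : 'I_n) :
  (M *m (delta_mx i j : 'M[F]_n)) x y = M x i * (y == j)%:R.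
Proof.
rewrite mxE (bigD1 i) //= big1 => [|k kj]; first by rewrite !mxE eqxx addr0.
by rewrite !mxE (negPf kj) mulr0.
Qed.

Let row_closer s (j y : 'I_n) : involutive s -> (s j <= j)%N -> N s j y = 0.
Proof.
move=> sK sj; rewrite mxE; have [<-|] := eqVneq (s j) y; last by rewrite andbF.
by rewrite ltnNge sj.
Qed.

Let col_opener s (i x : 'I_n) : involutive s -> (i <= s i)%N -> N s x i = 0.
Proof. by move=> sK si; rewrite /N matching_mxE // ltnNge si. Qed.

Lemma inner_move_degenerates s a b : involutive s -> obstruction s a b ->
  degenerates s (inner_move s a b).
Proof.
move=> sK ob; have /and3P[ab bsa obd] := ob.
have nbsa : (b == s a) = false by rewrite -val_eqE /= ltn_eqF.
have nasa : (a == s a) = false by rewrite -val_eqE /= ltn_eqF ?(ltn_trans ab).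
have nab : (a == b) = false by rewrite -val_eqE /= ltn_eqF.
have bsb : (b <= s b)%N by move: obd; rewrite -val_eqE /=; lia.
apply: (@tperm_degeneration _ _ _ _ _ 0) => //.
- move=> x; have [->|xb] := eqVneq x b.
    rewrite tpermL; have [->|nbb] := eqVneq (s b) b; first by rewrite tpermL !ltnn.
    move: obd; rewrite (negPf nbb) /= => obd'.
    by rewrite tpermD -?val_eqE /=; lia.
  have [->|xsa] := eqVneq x (s a).
    rewrite tpermR sK tpermD -?val_eqE /=; lia.
  have [->|xa] := eqVneq x a.
    by rewrite tpermR tpermD -?val_eqE /=; lia.
  have [e|xsb] := eqVneq x (s b).
    move: obd xb; rewrite e => /orP[->//|obd' _].
    by rewrite sK tpermL tpermD -?val_eqE /=; lia.
  rewrite !tpermD // 1?eq_sym ?(inj_eq perm_inj) //.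
  by apply: contraNneq xsb => <-; rewrite sK.
- by rewrite (inj_eq perm_inj) eq_sym nab.
- by move=> x y _; rewrite mxE.
- by move=> y; rewrite mxE.
apply/matrixP => x y; rewrite addr0 delta_mul mul_delta.
by rewrite row_closer ?col_opener ?sK ?mulr0 ?mul0r //; lia.
Qed.

(** If [b] is matched, [delta_mx a b *m N s] is the matrix unit at [(a, s b)], while the product in
    the other order vanishes. The correction [delta_mx (s a) (s b)] supplies the same matrix unit on
    the other side. *)
Lemma outer_move_degenerates s a b : involutive s -> obstruction s a b ->
  degenerates s (outer_move s a b).
Proof.
move=> sK ob; have /and3P[ab bsa obd] := ob.
have nbsa : (b == s a) = false by rewrite -val_eqE /= ltn_eqF.
have nasa : (a == s a) = false by rewrite -val_eqE /= ltn_eqF ?(ltn_trans ab).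
have nab : (a == b) = false by rewrite -val_eqE /= ltn_eqF.
have bsb : (b <= s b)%N by move: obd; rewrite -val_eqE /=; lia.
have asa : (a <= s a)%N by lia.
pose Z : 'M[F]_n := if s b == b then 0 else delta_mx (s a) (s b).
have nbsb : s b != b -> [/\ a == s b = false, b == s b = false & (s a < s b)%N].
  move=> nbb; move: (obd); rewrite (negPf nbb) /= => sab.
  by split=> //; rewrite -val_eqE /=; lia.
apply: (@tperm_degeneration _ _ _ _ _ Z) => //.
- move=> x; have [->|xa] := eqVneq x a.
    rewrite tpermL tpermD ?nasa ?nbsa //; lia.
  have [->|xb] := eqVneq x b.
    rewrite tpermR; have [->|nbb] := eqVneq (s b) b; first by rewrite tpermR !ltnn.
    by have [n1 n2 _] := nbsb nbb; rewrite tpermD ?n1 ?n2 //; lia.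
  rewrite [tperm a b x]tpermD // 1?eq_sym //.
  have [->|xsa] := eqVneq x (s a); first by rewrite sK tpermL; lia.
  have [e|xsb] := eqVneq x (s b).
    have [n1 n2 _] : [/\ a == s b = false, b == s b = false & (s a < s b)%N].
      by apply: nbsb; rewrite -e.
    by rewrite e sK tpermR; move: n1 n2; rewrite -!val_eqE /=; lia.
  rewrite tpermD //.
    by apply: contraNneq xsa => ->; rewrite sK.
  by apply: contraNneq xsb => ->; rewrite sK.
- by rewrite eq_sym nbsa.
- move=> x y yx; rewrite /Z; case: eqP => [_|/eqP nbb]; rewrite !mxE //.
  have [n1 n2 sab] := nbsb nbb.
  case: eqP => //= xsa; case: eqP => //= ty; exfalso.
  have ysb : y = s b by rewrite -[y](tpermK a b) ty tpermD ?n1 ?n2.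
  by move: yx; rewrite ysb xsa leqNgt sab.
- by move=> y; rewrite /Z; case: eqP; rewrite !mxE ?nasa.
apply/matrixP => x y; rewrite mulmxDl mulmxDr [LHS]mxE [RHS]mxE delta_mul mul_delta.
rewrite (col_opener _ sK asa) mul0r add0r /Z.
have [e|nbb] := eqVneq (s b) b.
  by rewrite (@row_closer s b y) ?e // mulr0 mul0mx mulmx0 !mxE addr0.
have [_ _ sab] := nbsb nbb.
rewrite delta_mul mul_delta (@row_closer s (s b) y) ?sK // mulr0 addr0.
rewrite /N [matching_mx F s x _]matching_mxE // sK (ltn_trans ab bsa) /=.
rewrite mxE [s b == y]eq_sym.
case: (y =P s b) => [->|_]; last by rewrite andbF !mulr0.
by rewrite (ltn_trans bsa sab) !mulr1.
Qed.

(** Conjugating by a diagonal matrix scales the entry of the arc by [e], which then tends to 0. *)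
Lemma remove_arc_degenerates t (q : 'I_n) : involutive t -> (q < t q)%N ->
  degenerates (remove_arc t q) t.
Proof.
move=> tK qtq v [A bA <-]; have [uA _] := bA.
set r := remove_arc t q.
have rq : r q = q by rewrite /r remove_arcE // eqxx.
apply: (@zariski_closure_line _ _ _ _ (A *m delta_mx q (t q) *m invmx A)).
  by apply: strictly_upper_conj => //; apply: matching_strictly_upper.
move=> e e0.
have -> : A *m N r *m invmx A + e *: (A *m delta_mx q (t q) *m invmx A) =
    A *m (N r + e *: delta_mx q (t q)) *m invmx A.
  by rewrite [in RHS]mulmxDr [in RHS]mulmxDl -scalemxAr -scalemxAl.
apply: borel_orbit_trans => //; apply/borel_orbitP.
pose d : 'rV[F]_n := \row_i (if i == q then e else 1).
exists (diag_mx d).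
  apply: upper_borel => [i j ji|i]; rewrite !mxE.
    by rewrite (_ : (i == j) = false) // -val_eqE /= gtn_eqF.
  by rewrite eqxx mulr1n; case: ifP; rewrite ?oner_neq0.
apply/matrixP => i j; rewrite mul_mx_diag mul_diag_mx !mxE remove_arcE //.
have [->|iq] := eqVneq i q.
  rewrite /= [q == j]eq_sym; have [->|jq] := eqVneq j q.
    rewrite ltnn add0r /= (_ : (q == t q) = false) ?mulr0 ?mul0r //.
    by rewrite -val_eqE /= ltn_eqF.
  rewrite andbF add0r [t q == j]eq_sym mulr1.
  by have [->|] := eqVneq j (t q); rewrite ?qtq ?andbF.
rewrite mulr0 addr0 mul1r /=; have [->|itq] /= := eqVneq i (t q).
  rewrite tK; have [<-|] := eqVneq (t q) j.
    by rewrite ltnn mul0r; case: eqP qtq => [<-|_]; rewrite ?ltnn ?andbF.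
  rewrite andbF mul0r => _; have [<-|] := eqVneq q j; last by rewrite andbF.
  by rewrite ltnNge ltnW.
have [e'|jq] := eqVneq j q; last by rewrite mulr1.
rewrite e'; have [h|] := eqVneq (t i) q; last by rewrite andbF mul0r.
by case/eqP: itq; rewrite -h tK.
Qed.

Lemma planar_same_closers s : involutive s -> exists t,
  [/\ involutive t, planar t, degenerates s t & forall b, (t b < b)%N = (s b < b)%N].
Proof.
elim/moves_ind: s / => s sK => [pl|[a [b ob]] IHs].
  by exists s; split=> //; apply: degenerates_refl.
have [_ lt_w] := arcs_in_moves sK ob (or_intror erefl).
have [|t [tK plt deg cl]] := IHs _ _ lt_w; first exact: conj_involutive.
exists t; split=> //; last by move=> x; rewrite cl outer_move_closers.
by apply: degenerates_trans deg; apply: outer_move_degenerates.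
Qed.

(** If [s] is planar, its closers are among those of [t] and equally many, so the matchings
    coincide. Otherwise one move stays below [t], and its number of arcs is squeezed between two
    equal values. *)
Lemma arcs_le_same_size t : involutive t -> planar t -> forall s, involutive s ->
  arcs_le s t -> arcs_in s 0 n = arcs_in t 0 n -> degenerates s t.
Proof.
move=> tK plt; apply: moves_ind => s sK => [pls|[a [b ob]] IHs] le_st eq_st.
  have cl := arcs_le_closers sK tK pls plt le_st.
  suff -> : s = t by apply: degenerates_refl.
  apply: planar_closers_inj => // b.
  apply/idP/idP => [/cl //|tb]; apply: contraT => nsb.
  suff : (arcs_in s 0 n < arcs_in t 0 n)%N by rewrite eq_st ltnn.
  rewrite !arcs_in_closers // (bigD1 b) //= [ltnRHS](bigD1 b) //=.
  rewrite (negPf nsb) tb ltn_ord /= add0n add1n ltnS; apply: leq_sum => c _.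
  by have := cl c; rewrite ltn_ord !andbT /=; case: (s c < c)%N => // ->.
have [u [defu deg le_ut]] : exists u, [/\ u = inner_move s a b \/ u = outer_move s a b,
    degenerates s u & arcs_le u t].
  case: (moves_below sK ob tK plt le_st) => le_ut.
    by exists (inner_move s a b); split=> //; [left|exact: inner_move_degenerates].
  by exists (outer_move s a b); split=> //; [right|exact: outer_move_degenerates].
have [le_su lt_w] := arcs_in_moves sK ob defu.
have uK : involutive u by case: defu => ->; apply: conj_involutive.
apply: degenerates_trans deg _; apply: (IHs _ uK lt_w) => //.
by apply/eqP; rewrite eqn_leq le_ut -eq_st le_su.
Qed.

(** Outer arcs of [t] are removed until as many remain as in [s]. Planarity makes [r] the matching
    of a tableau, and the equal count gives the rank needed for the nilpotent class. *)
Lemma degenerates_through s t : involutive s -> involutive t -> planar t ->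
  arcs_le s t -> exists r : 'S_n, [/\ involutive r, planar r, arcs_in r 0 n = arcs_in s 0 n,
    degenerates s r & degenerates r t].
Proof.
move=> sK; have [m] := ubnP (arcs_in t 0 n); elim: m t => // m IHm t lt_m tK plt le_st.
have [eq_st|ne_st] := eqVneq (arcs_in s 0 n) (arcs_in t 0 n).
  by exists t; split=> //; [apply: arcs_le_same_size|apply: degenerates_refl].
have lt_st : (arcs_in s 0 n < arcs_in t 0 n)%N by rewrite ltn_neqAle ne_st le_st.
have [q outq le_sr] := arcs_le_remove sK tK plt le_st lt_st.
have /andP[qtq _] := outq.
have lt_r : (arcs_in (remove_arc t q) 0 n < arcs_in t 0 n)%N.
  by rewrite (arcs_in_remove 0 n tK qtq) ltn_ord leq0n addn1.
have [r [rK plr eqr deg_sr deg_rt]] := IHm (remove_arc t q) (leq_trans lt_r lt_m)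
  (remove_arc_involutive q tK) (remove_arc_planar tK plt outq) le_sr.
exists r; split=> //; apply: degenerates_trans deg_rt _.
exact: remove_arc_degenerates.
Qed.

End Chains.

(** * Jordan type of matrices of square zero *)

Section SquareZero.
Variable F : fieldType.

Lemma rank_basis m n (A : 'M[F]_(m, n)) c : \rank A = c ->
  exists B : 'M[F]_(c, n), (B :=: A)%MS /\ row_free B.
Proof.
by move=> <-; exists (row_base A); split; [apply: eq_row_base|apply: row_base_free].
Qed.

(** The rows of [Q] are a basis [B] of the image, preceded by preimages [W] of it and followed by a
    basis [C] of a complement of the image in the kernel. *)
Lemma square_zero_normal_form r c (u : 'M[F]_(r + (r + c))) :
  u *m u = 0 -> \rank u = r -> exists2 Q, Q \in unitmx &
    Q *m u = block_mx 0 (row_mx 1%:M 0) 0 0 *m Q.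
Proof.
move=> uu rk; have [B [eqB freeB]] := rank_basis rk.
have le_uk : (u <= kermx u)%MS by apply/sub_kermxP.
have eq_cap : (kermx u :&: u :=: u)%MS := capmx_idPr le_uk.
have rk_cap : \rank (kermx u :&: u)%MS = r by rewrite eq_cap.
have rkC : \rank (kermx u :\: u)%MS = c.
  by have := mxrank_cap_compl (kermx u) u; rewrite rk_cap mxrank_ker rk; lia.
have [C [eqC _]] := rank_basis rkC.
have eqBC : (B + C :=: kermx u)%MS.
  apply: eqmx_trans (adds_eqmx eqB eqC) _; rewrite addsmxC.
  apply: eqmx_trans (addsmx_diff_cap_eq (kermx u) u).
  exact: adds_eqmx (eqmx_refl _) (eqmx_sym eq_cap).
have Bu : B *m u = 0 by apply/sub_kermxP; rewrite -eqBC addsmxSl.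
have Cu : C *m u = 0 by apply/sub_kermxP; rewrite -eqBC addsmxSr.
have [W Wu] : exists W, W *m u = B.
  by exists (B *m pinvmx u); rewrite mulmxKpV // eqB.
have freeBC : row_free (col_mx B C).
  rewrite /row_free -addsmxE eqBC mxrank_ker rk; apply/eqP; lia.
exists (col_mx W (col_mx B C)).
  rewrite -row_free_unit; apply: inj_row_free => v.
  rewrite -[v]hsubmxK mul_row_col => e.
  have v1 : lsubmx v = 0.
    apply: (row_free_inj freeB); rewrite mul0mx.
    have := congr1 (mulmx^~ u) e; rewrite mulmxDl mul0mx -!mulmxA Wu.
    by rewrite mul_col_mx Bu Cu col_mx0 mulmx0 addr0.
  move: e; rewrite v1 mul0mx add0r => e.
  have -> : rsubmx v = 0 by apply: (row_free_inj freeBC); rewrite mul0mx.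
  by rewrite row_mx0.
rewrite mul_col_mx Wu mul_col_mx Bu Cu mul_block_col mul_row_col !mul0mx mul1mx.
by rewrite !addr0 add0r col_mx0.
Qed.

Lemma square_zero_similar n (u v : 'M[F]_n) : u *m u = 0 -> v *m v = 0 ->
  \rank u = \rank v -> exists2 P, P \in unitmx & u = P *m v *m invmx P.
Proof.
move=> uu vv; move er : (\rank v) => r eu.
have [c en] : exists c, n = (r + (r + c))%N.
  have := mulmx0_rank_max uu; rewrite eu => le; exists (n - r - r)%N; lia.
subst n; have [Q uQ eQ] := square_zero_normal_form uu eu.
have [Q' uQ' eQ'] := square_zero_normal_form vv er.
exists (invmx Q *m Q'); first by rewrite unitmx_mul unitmx_inv uQ.
apply: (canRL (mulmxK _)); first by rewrite unitmx_mul unitmx_inv uQ.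
apply: (can_inj (mulKmx uQ)); rewrite -[invmx Q *m Q' *m v]mulmxA eQ' !mulmxA eQ.
by rewrite mulmxK // mulmxV // mul1mx.
Qed.

Lemma jordan_block_square m : (m <= 2)%N ->
  nilpotent_jordan_block F m *m nilpotent_jordan_block F m = 0.
Proof.
move=> le2; apply/matrixP => i j; rewrite !mxE big1 // => k _; rewrite !mxE.
have := ltn_ord i; have := ltn_ord j; have := ltn_ord k.
case: eqP => [e1|]; last by rewrite mul0r.
case: eqP => [e2|]; last by rewrite mulr0.
lia.
Qed.

Lemma jordan_block_rank m : (m <= 2)%N -> \rank (nilpotent_jordan_block F m) = m.-1.
Proof.
case: m => [|[|[|]]] // _; first by rewrite thinmx0 mxrank0.
  rewrite (_ : nilpotent_jordan_block F 1 = 0) ?mxrank0 //.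
  by apply/matrixP => i j; rewrite !mxE !ord1.
rewrite (_ : nilpotent_jordan_block F 2 = delta_mx ord0 ord_max) ?mxrank_delta //.
by apply/matrixP => -[[|[|]] //= i] [[|[|]] //= j]; rewrite !mxE.
Qed.

Lemma jordan_mx_square mu : all (fun m => (m <= 2)%N) mu ->
  nilpotent_jordan_mx F mu *m nilpotent_jordan_mx F mu = 0.
Proof.
move=> /all_nthP le2; rewrite /nilpotent_jordan_mx mul_mxdiag_mxblock -[RHS]mxblock0.
apply: eq_mxblock => i j; have [->|ij] := eqVneq i j; last by rewrite mulmx0.
by rewrite conform_mx_id jordan_block_square // le2.
Qed.

Lemma jordan_mx_rank mu : all (fun m => (0 < m <= 2)%N) mu ->
  (\rank (nilpotent_jordan_mx F mu) + size mu = \sum_(k < size mu) nth 0%N mu k)%N.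
Proof.
move=> /all_nthP bnd; rewrite /nilpotent_jordan_mx rank_mxdiag.
rewrite -[X in (_ + X)%N]card_ord -sum1_card -big_split /=.
apply: eq_bigr => k _; have /andP[gt0 le2] := bnd 0%N k (ltn_ord k).
by rewrite jordan_block_rank // addn1 prednK.
Qed.

Lemma jordan_cast mu n (e : (\sum_(k < size mu) nth 0 mu k)%N = n) :
  all (fun m => (0 < m <= 2)%N) mu ->
  let J := castmx (e, e) (nilpotent_jordan_mx F mu) in
  J *m J = 0 /\ (\rank J + size mu)%N = n.
Proof.
case: n / e => bnd; rewrite castmx_id; split; last exact: jordan_mx_rank.
by apply: jordan_mx_square; apply: sub_all bnd => m /andP[].
Qed.

Lemma conjugate_partition_head mu : 0%N \notin mu ->
  head 0%N (conjugate_partition mu) = size mu.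
Proof.
move=> mu0; have all_gt0 : all (leq 1) mu.
  by apply/allP => m m_mu; rewrite lt0n; apply: contraNneq mu0 => <-.
rewrite /conjugate_partition; case: mu {mu0} all_gt0 => [|m mu] all_gt0.
  by rewrite big_nil.
have : (0 < \max_(x <- m :: mu) x)%N.
  by rewrite big_cons (leq_trans _ (leq_maxl _ _)) //; case/andP: all_gt0.
case: (\max_(x <- _) x)%N => // k _; apply/eqP.
by rewrite -[head _ _]/(count (leq 1) (m :: mu)) -all_count.
Qed.

(** At most two columns means Jordan blocks of size at most 2, and the first column counts the
    blocks, each of which has corank one. *)
Lemma has_sh_two_columns n (u : 'M[F]_n) lam : has_sh u lam -> (size lam <= 2)%N ->
  u *m u = 0 /\ (\rank u + head 0%N lam)%N = n.
Proof.
case=> mu [mu0 [e [P [uP ->]]]] ->; rewrite size_map size_iota => max2.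
have bnd : all (fun m => (0 < m <= 2)%N) mu.
  apply/allP => m m_mu; rewrite lt0n (contraNneq _ mu0); last by move=> <-.
  by apply: leq_trans max2; apply: (leq_bigmax_seq m).
rewrite conjugate_partition_head //; have [JJ rkJ] := jordan_cast e bnd.
split; first by rewrite conj_mul // JJ mulmx0 mul0mx.
rewrite mxrankMfree ?row_free_unit ?unitmx_inv // -[RHS]rkJ; congr (_ + _)%N.
by rewrite -mxrank_tr trmx_mul mxrankMfree ?mxrank_tr // row_free_unit unitmx_tr.
Qed.

Lemma conjugate_partition_two m r : (r.*2 <= m)%N ->
  conjugate_partition (nseq r 2 ++ nseq (m - r.*2) 1) = two_column_shape m r.
Proof.
move=> le_rm; rewrite /conjugate_partition /two_column_shape.
have cnt i : count (leq i) (nseq r 2 ++ nseq (m - r.*2) 1) =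
    ((i <= 2) * r + (i <= 1) * (m - r.*2))%N by rewrite count_cat !count_nseq.
case: r le_rm cnt => [|r] le_rm cnt.
  rewrite double0 subn0 in cnt *; case: m {le_rm} cnt => [|m] cnt; first by rewrite big_nil.
  have -> : (\max_(x <- nseq 0 2 ++ nseq m.+1 1) x)%N = 1%N.
    apply/eqP; rewrite eqn_leq; apply/andP; split.
      by apply/bigmax_leqP_seq => x; rewrite mem_nseq => /andP[_ /eqP ->].
    by apply: (@leq_bigmax_seq _ _ xpredT id 1%N); rewrite ?mem_nseq.
  by have := cnt 1%N; rewrite /= => ->; rewrite !mul1n.
have -> : (\max_(x <- nseq r.+1 2 ++ nseq (m - r.+1.*2) 1) x)%N = 2%N.
  apply/eqP; rewrite eqn_leq; apply/andP; split.
    apply/bigmax_leqP_seq => x; rewrite mem_cat !mem_nseq.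
    by case/orP => /andP[_ /eqP ->].
  by apply: (@leq_bigmax_seq _ _ xpredT id 2%N); rewrite ?mem_cat ?mem_nseq.
have := cnt 1%N; have := cnt 2%N; rewrite /= !mul1n !mul0n addn0 => -> ->.
rewrite (_ : (r.+1 + (m - r.+1.*2) = m - r.+1)%N); last by lia.
by rewrite (_ : (m - r.+1 != 0)%N) //; lia.
Qed.

Lemma square_zero_has_sh n (u : 'M[F]_n) : u *m u = 0 ->
  has_sh u (two_column_shape n (\rank u)).
Proof.
move=> uu; have le_rn : ((\rank u).*2 <= n)%N by have := mulmx0_rank_max uu; rewrite addnn.
set r := \rank u in le_rn *.
(* A Jordan matrix with these blocks has square zero and the rank of [u], hence is similar to
   [u]. *)
pose mu := (nseq r 2 ++ nseq (n - r.*2) 1)%N.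
have bnd : all (fun m => (0 < m <= 2)%N) mu by rewrite all_cat !all_nseq /= !orbT.
exists mu; last by rewrite conjugate_partition_two.
split.
  by rewrite mem_cat !mem_nseq !andbF.
have e : (\sum_(k < size mu) nth 0 mu k)%N = n.
  rewrite -(big_mkord xpredT (nth 0%N mu)) -(big_nth 0%N xpredT id) big_cat /=.
  by rewrite !big_nseq !iter_addn; lia.
exists e.
have [JJ rkJ] := jordan_cast e bnd.
have [|P uP eP] := square_zero_similar uu JJ; last by exists P.
have sz : size mu = (n - r)%N by rewrite size_cat !size_nseq; lia.
by rewrite -/r; lia.
Qed.

End SquareZero.

(** * Closures of orbital varieties *)

Section UpperLeft.
Variables (F : fieldType) (n : nat).
Implicit Types (u v : 'M[F]_n) (s t : 'S_n).

(** The corner retains all rows, but those from [i] on vanish in the columns before [i]. *)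
Lemma upper_left_rank u i (le_in : (i <= n)%N) : strictly_upper u ->
  \rank (upper_left le_in u) = \rank (corner u 0 i).
Proof.
move=> su; pose w := widen_ord le_in; pose E : 'M[F]_(i, n) := rowsub w 1%:M.
have e1 : upper_left le_in u = E *m corner u 0 i *m E^T.
  rewrite /E -rowsubE trmx_mxsub trmx1 mulmx_colsub mulmx1.
  by apply/matrixP => a c; rewrite !mxE /= ltn_ord.
have e2 : corner u 0 i = E^T *m upper_left le_in u *m E.
  have lift p (M : 'M[F]_(i, p)) a x : (E^T *m M) a x =
      if insub (val a) is Some k then M k x else 0.
    rewrite mxE; case: insubP => [k _ ak|ai].
      rewrite (bigD1 k) //= big1 => [|l lk].
        by rewrite !mxE (_ : w k = a) ?eqxx ?mul1r ?addr0 //; apply: val_inj.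
      rewrite !mxE (_ : (w l == a) = false) ?mul0r //; apply: contraNF lk => /eqP la.
      by apply/eqP/val_inj; rewrite /= ak -la.
    rewrite big1 // => k _; rewrite !mxE (_ : (w k == a) = false) ?mul0r //.
    by apply: contraNF ai => /eqP <-; rewrite /= ltn_ord.
  apply: trmx_inj; rewrite trmx_mul; apply/matrixP => c a.
  rewrite lift mxE [RHS]/=; case: insubP => [k _ ck|ci]; last first.
    by rewrite mxE /= (negPf ci).
  rewrite [RHS]mxE lift; case: insubP => [l _ al|ai].
    by rewrite !mxE /= -ck ltn_ord; congr (u _ _); apply: val_inj; rewrite /= ?al ?ck.
  rewrite mxE; case: ifP => // _; apply: su; by move: ai ck (ltn_ord k) => /=; lia.
apply/eqP; rewrite eqn_leq; apply/andP; split; [rewrite e1|rewrite {1}e2];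
  by apply: leq_trans (mxrankM_maxl _ _) _; apply: mxrankM_maxr.
Qed.

Lemma arcs_in_double s i : involutive s -> (i <= n)%N -> ((arcs_in s 0 i).*2 <= i)%N.
Proof.
move=> sK le_in; rewrite arcs_in_matched //.
rewrite -[X in (_ <= X)%N]subn0 -(ord_card_interval (leq0n i) le_in).
by apply: leq_sum => b _; lia.
Qed.

(** The point [b] is a closer exactly when the prefix count grows from [b] to [b + 1]. *)
Lemma arcs_in_prefix_closers s t : involutive s -> involutive t ->
  (forall i, (i <= n)%N -> arcs_in s 0 i = arcs_in t 0 i) ->
  forall b, (s b < b)%N = (t b < b)%N.
Proof.
move=> sK tK eq_st b.
have step (u : 'S_n) : involutive u ->
    arcs_in u 0 b.+1 = (arcs_in u 0 b + (u b < b))%N.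
  move=> uK; rewrite !arcs_in_closers // (bigD1 b) //= [in RHS](bigD1 b) //=.
  rewrite ltnn andbF add0n ltnSn andbT addnC; congr (_ + _)%N.
  by apply: eq_bigr => c; rewrite -val_eqE /=; lia.
have := eq_st b (ltnW (ltn_ord b)); have := eq_st b.+1 (ltn_ord b).
by rewrite !step //; case: (s b < b)%N; case: (t b < b)%N; lia.
Qed.

Lemma head_two_column_shape m r : (0 < m)%N -> (r.*2 <= m)%N ->
  head 0%N (two_column_shape m r) = (m - r)%N.
Proof. by move=> m0 rm; rewrite /two_column_shape /= (_ : (m - r != 0)%N) //; lia. Qed.

Lemma size_two_column_shape m r : (size (two_column_shape m r) <= 2)%N.
Proof. by rewrite size_filter; apply: leq_trans (count_size _ _) _. Qed.

Lemma upper_left_mul u v i (le_in : (i <= n)%N) : strictly_upper v ->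
  upper_left le_in (u *m v) = upper_left le_in u *m upper_left le_in v.
Proof.
move=> sv; apply/matrixP => a c; rewrite !mxE.
rewrite (bigID (fun k : 'I_n => k < i)%N) /= [X in _ + X]big1 ?addr0; last first.
  by move=> k; rewrite -leqNgt => ik; rewrite sv ?mulr0 //=; have := ltn_ord c; lia.
rewrite (big_ord_narrow le_in) /=.
by apply: eq_bigr => k _; rewrite !mxE.
Qed.

Lemma upper_left_full u : upper_left (leqnn n) u = u.
Proof. by apply/matrixP => a c; rewrite mxE; congr (u _ _); apply: val_inj. Qed.

Lemma nu_matching s u : involutive s ->
  nu (matching_tableau s) u <-> [/\ strictly_upper u, u *m u = 0
    & forall i, (i <= n)%N -> \rank (corner u 0 i) = arcs_in s 0 i].
Proof.
move=> sK; split=> [[su sh_u]|[su uu rk]].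
  have key i (le_in : (i <= n)%N) : (0 < i)%N ->
      upper_left le_in u *m upper_left le_in u = 0 /\
      \rank (corner u 0 i) = arcs_in s 0 i.
    move=> i0; have := sh_u i le_in i0; rewrite matching_shape // => /has_sh_two_columns.
    move=> /(_ (size_two_column_shape _ _)) [uu].
    rewrite head_two_column_shape ?arcs_in_double // upper_left_rank // => rk.
    by split=> //; have := arcs_in_double sK le_in; lia.
  split=> //.
    (* The condition in [nu] concerns only [0 < i], so for [n = 0] it says nothing and the equation
       holds for lack of entries. *)
    have [n0|n_gt0] := posnP n.
      by apply/matrixP => a; have := leq_trans (ltn_ord a) (eq_leq n0).
    by have [+ _] := key n (leqnn n) n_gt0; rewrite upper_left_full.
  move=> [|i] le_in; last by have [] := key i.+1 le_in isT.
  rewrite (_ : corner u 0 0 = 0) ?mxrank0 /arcs_in ?big1 // => [a _|].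
    by rewrite ltn0 !andbF.
  by apply/matrixP => a c; rewrite !mxE.
split=> // i le_in i0; rewrite matching_shape // -rk // -(upper_left_rank le_in) //.
apply: square_zero_has_sh; rewrite -upper_left_mul // uu.
by apply/matrixP => a c; rewrite !mxE.
Qed.

Lemma nilpotent_class_matching s u : involutive s -> u *m u = 0 ->
  \rank u = arcs_in s 0 n -> nilpotent_class (Defs.shape (matching_tableau s)) u.
Proof.
move=> sK uu rk; split; first by exists 2%N; rewrite expr2.
by rewrite matching_shape_full // -rk; apply: square_zero_has_sh.
Qed.

End UpperLeft.

(** * Decomposition of the closure *)

Section Main.
Variables (F : numFieldType) (n : nat).
Implicit Types (s t : 'S_n).

Let N s := matching_mx F s.
Let O s := borel_orbit (N s).

Lemma orbit_sub_nu s : involutive s -> O s `<=` @nu F n (matching_tableau s).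
Proof.
move=> sK u Ou; apply/nu_matching => //; split.
- exact: borel_orbit_strictly_upper (matching_strictly_upper F s) Ou.
- exact: borel_orbit_square (matching_square F sK) Ou.
- by move=> i _; rewrite (corner_rank_orbit _ _ Ou) matching_corner_rank.
Qed.

(** The prefix ranks of [u] determine the closers of its normal form. Outer moves lead from there to
    a planar matching with these closers, which can only be [s]. *)
Lemma nu_sub_orbit_closure s : involutive s -> planar s ->
  @nu F n (matching_tableau s) `<=` zariski_closure (O s).
Proof.
move=> sK pl u /(nu_matching _ sK)[su uu rk].
have [t tK Ou] := matching_normal_form su uu.
have [r [rK plr deg cl]] := planar_same_closers F tK.
have <- : r = s.
  apply: planar_closers_inj => // b; rewrite cl; move: b.
  apply: arcs_in_prefix_closers => // i le_in.
  by rewrite -rk // (corner_rank_orbit _ _ Ou) matching_corner_rank.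
exact: deg.
Qed.

Lemma nu_closure s : involutive s -> planar s ->
  zariski_closure (@nu F n (matching_tableau s)) = zariski_closure (O s).
Proof.
move=> sK pl; apply/seteqP; split; apply: zariski_closure_sub.
  exact: nu_sub_orbit_closure.
by move=> u /(orbit_sub_nu sK); apply: sub_zariski_closure.
Qed.

(** The orbital variety lies between [nu] and its closure. *)
Lemma orbital_variety_closure s : involutive s -> planar s ->
  zariski_closure (@orbital_variety F n (matching_tableau s)) = zariski_closure (O s).
Proof.
move=> sK pl; rewrite -nu_closure //; apply/seteqP; split; apply: zariski_closure_sub.
  by move=> u [].
move=> u nu_u; apply: sub_zariski_closure; split; first exact: sub_zariski_closure.
have [su uu rk] := (nu_matching u sK).1 nu_u.
by apply: nilpotent_class_matching => //; rewrite -rk // corner_full.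
Qed.

Lemma orbit_closure_rank s u : involutive s -> zariski_closure (O s) u ->
  [/\ strictly_upper u, u *m u = 0
    & forall i j, (\rank (corner u i j) <= arcs_in s i j)%N].
Proof.
move=> sK; apply: (@zariski_closure_min _ _ _ [set v | [/\ _, _ & _]]).
  exact: zariski_closed_corners.
move=> {}u Ou.
split; first exact: borel_orbit_strictly_upper (matching_strictly_upper F s) Ou.
  exact: borel_orbit_square (matching_square F sK) Ou.
by move=> i j; rewrite (corner_rank_orbit _ _ Ou) matching_corner_rank.
Qed.

Lemma orbit_B_matching T s : two_column_tableaux n T -> involutive s -> planar s ->
  has_closers T s -> @orbit_B F n T = O s.
Proof.
move=> hT sK pl cl; rewrite /orbit_B /O; congr borel_orbit.
by apply/matrixP => a b; rewrite /N !mxE (sigma_mem hT sK pl cl) (can2_eq sK sK) eq_sym.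
Qed.

Theorem orbital_variety_closure_union T : two_column_tableaux n T ->
  zariski_closure (@orbital_variety F n T) =
  \bigcup_(S in [set S | two_column_tableaux n S /\ tableau_ge F n S T])
    @orbital_variety F n S.
Proof.
move=> hT; have [t [tK plt clt]] := planar_matching_exists hT.
rewrite {1}(two_column_closers hT clt) orbital_variety_closure //.
apply/seteqP; split=> [u ut|u [S [hS ge_ST] [uS _]]]; last first.
  have [s [sK pls cls]] := planar_matching_exists hS.
  move: ge_ST; rewrite /tableau_ge (orbit_B_matching hT tK plt clt).
  rewrite (orbit_B_matching hS sK pls cls); apply.
  by rewrite -nu_closure // -(two_column_closers hS cls).
have [su uu rk] := orbit_closure_rank tK ut.
have [s sK Ou] := matching_normal_form su uu.
have rk_u i j : \rank (corner u i j) = arcs_in s i j.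
  by rewrite (corner_rank_orbit _ _ Ou) matching_corner_rank.
have le_st : arcs_le s t by move=> i j; rewrite -rk_u.
(* The tableau of [r] is the required [S]: [deg_rt] gives [S >= T], [deg_sr] puts [u] in the closure
   of [nu], and [eq_r] gives its Jordan type. *)
have [r [rK plr eq_r deg_sr deg_rt]] := degenerates_through F sK tK plt le_st.
have hS := matching_tableau_two_column rK.
have clr := matching_tableau_closers rK.
exists (matching_tableau r).
  split=> //; rewrite /tableau_ge (orbit_B_matching hT tK plt clt).
  by rewrite (orbit_B_matching hS rK plr clr); apply: zariski_closure_sub.
split; first by rewrite nu_closure //; apply: deg_sr.
by apply: nilpotent_class_matching => //; rewrite eq_r -rk_u corner_full.
Qed.

End Main.

Theorem theorem4p5 (R : realType) (n : nat) (T : tableau)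
    (hT : two_column_tableaux n T) :
  zariski_closure (@orbital_variety R[i]%C n T) =
  \bigcup_(S in [set S | two_column_tableaux n S /\ tableau_ge R[i]%C n S T])
    @orbital_variety R[i]%C n S.
Proof. exact: orbital_variety_closure_union. Qed.
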